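(* Let $q$ be a prime power. (a) Let $C\subset\mathbb{P}^2$ be a plane curve of degree $q$ defined over $\mathbb{F}_q$ without an $\mathbb{F}_q$-linear component. Unless $q=4$ and $C$ is projectively equivalent over $\mathbb{F}_4$ to the curve $$X^4+Y^4+Z^4+X^2Y^2+Y^2Z^2+Z^2X^2+X^2YZ+XY^2Z+XYZ^2=0,$$ one has $N_q(C)\le (q-1)q+1$. (b) For each prime power $q$ there exists a nonsingular plane curve $C$ of degree $q$ over $\mathbb{F}_q$ with $N_q(C)=(q-1)q+1$.
   Context: A plane curve $C$ of degree $d$ over $\mathbb{F}_q$ is given by a nonzero homogeneous polynomial $F(X,Y,Z)\in\mathbb{F}_q[X,Y,Z]$ of degree $d$. It is without an $\mathbb{F}_q$-linear component if $F$ has no factor of degree $1$ with coefficients in $\mathbb{F}_q$. $C(\mathbb{F}_q)$ is the set of points $(\alpha,\beta,\gamma)\in\mathbb{P}^2(\mathbb{F}_q)$ with $F(\alpha,\beta,\gamma)=0$ (whether singular or not), and $N_q(C)=\#C(\mathbb{F}_q)$. Two curves are projectively equivalent over $\mathbb{F}_q$ if one is carried to the other by an element of $PGL_3(\mathbb{F}_q)$ (i.e. their equations agree up to an invertible $\mathbb{F}_q$-linear change of variables and a nonzero scalar factor). Nonsingular means that $F$ and its partial derivatives have no common zero in $\mathbb{P}^2(\overline{\mathbb{F}}_q)$. *)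

(* Defs.v *)
From mathcomp Require Import all_boot all_order all_algebra all_field.
From mathcomp Require Import mpoly.

Set Implicit Arguments.
Unset Strict Implicit.
Unset Printing Implicit Defensive.

Import GRing.Theory.
Local Open Scope ring_scope.

Definition prime_power (q : nat) : Prop :=
  exists p k : nat, [/\ prime p, (0 < k)%N & q = (p ^ k)%N].

(* [d.-homog] also holds of the zero polynomial, so nonzeroness is separate. *)
Definition plane_curve (F : fieldType) (d : nat) (f : {mpoly F[3]}) : Prop :=
  f != 0 /\ f \is d.-homog.

(* [msize] is the total degree plus one.  A factor of a nonzero homogeneous
   polynomial is homogeneous, so degree 1 means a linear form here. *)
Definition no_linear_component (F : fieldType) (f : {mpoly F[3]}) : Prop :=
  forall l g : {mpoly F[3]}, f = l * g -> msize l <> 2%N.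

(* A point of P^2(F) is represented by the class of its homogeneous coordinate
   vectors under multiplication by nonzero scalars. *)
Definition proj_point (F : finFieldType) (v : 'rV[F]_3) : {set 'rV[F]_3} :=
  [set a *: v | a : F & a != 0].

Definition rational_points (F : finFieldType) (f : {mpoly F[3]}) :
    {set {set 'rV[F]_3}} :=
  [set proj_point v | v : 'rV[F]_3 & (v != 0) && (f.@[v ord0] == 0)].

Definition num_points (F : finFieldType) (f : {mpoly F[3]}) : nat :=
  #|rational_points f|.

Definition linear_subst (F : fieldType) (A : 'M[F]_3) (f : {mpoly F[3]}) :
    {mpoly F[3]} :=
  f \mPo [tuple \sum_(j < 3) A i j *: 'X_j | i < 3].

Definition proj_equivalent (F : fieldType) (f g : {mpoly F[3]}) : Prop :=
  exists (A : 'M[F]_3) (c : F),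
    [/\ A \in unitmx, c != 0 & f = c *: linear_subst A g].

Definition alg_closure (F : finFieldType) : closedFieldType :=
  tag (countable_algebraic_closure F).

Definition to_alg_closure (F : finFieldType) : {rmorphism F -> alg_closure F} :=
  sval (tagged (countable_algebraic_closure F)).

Definition nonsingular (F : finFieldType) (f : {mpoly F[3]}) : Prop :=
  let fbar := map_mpoly (to_alg_closure F) f in
  forall v : 'rV[alg_closure F]_3, v != 0 ->
    ~ (fbar.@[v ord0] = 0 /\ forall i : 'I_3, (fbar^`M(i)).@[v ord0] = 0).

Definition exceptional_quartic (F : fieldType) : {mpoly F[3]} :=
  let X : {mpoly F[3]} := 'X_(0 : 'I_3) in
  let Y : {mpoly F[3]} := 'X_(1 : 'I_3) in
  let Z : {mpoly F[3]} := 'X_(2 : 'I_3) in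
  X ^+ 4 + Y ^+ 4 + Z ^+ 4
  + X ^+ 2 * Y ^+ 2 + Y ^+ 2 * Z ^+ 2 + Z ^+ 2 * X ^+ 2
  + X ^+ 2 * Y * Z + X * Y ^+ 2 * Z + X * Y * Z ^+ 2.

(* Main.v *)
Require Import Defs.
From mathcomp Require Import all_boot all_order all_algebra all_field.
From mathcomp Require Import mpoly ring zify.

(** A curve [p] of degree [q] without linear component is nonzero at some point
    of every line, so the set [B] of points where [p] does not vanish is a
    blocking set; it has to be shown that [#|B| >= 2 q].  As [p] has low degree,
    [\sum_v p v * g v = 0] for every product [g] of [q - 2] linear forms; hence
    the points of [B] other than a given [P] are never covered by [q - 2] lines
    that avoid [P].  If [#|B| < 2 q], projecting from a point outside [B] shows
    that a line has at most [q - 1] points of [B] (or is contained in [B], which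
    is impossible), while double counting gives a line with at least three points
    of [B], and with at least four if [q >= 5].  For [q >= 5] the points off the
    longest secant can be covered in pairs, a contradiction.  For [q = 4] the set
    [B] is a Fano plane and [p] is determined up to a scalar.

    The bound is attained by [X^q - X Z^(q-1) + X^(q-1) Y - Y^q]. *)

Set Implicit Arguments.
Unset Strict Implicit.
Unset Printing Implicit Defensive.

Import GRing.Theory.

(** * Power sums and forms over a finite field *)

(** The degree [q] matters in two ways. A form of degree [q] that vanishes at every vector is zero,
    whereas [X^q Y - X Y^q] has degree [q + 1]; hence a line on which [p] vanishes is a component.
    Moreover, [p] times [q - 2] linear forms has degree [2 q - 2]. This is less than [3 (q - 1)], so
    the values of the product on [F^3] sum to 0; it is also a multiple of [q - 1], so the product is
    constant on the [q - 1] nonzero multiples of [P], which together contribute minus its value at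
    [P]. The value at [P] is therefore 0 as soon as the product vanishes elsewhere. The quadratic
    that yields a secant with four points has discriminant [-3 q^2 + 12 q + 4], which is negative
    from [q = 5] on but equals 4 at [q = 4]. In that case three points off a secant with three
    points would have to lie on a single line, and the seven points of a Fano plane escape. *)

Section PowerSums.

Local Open Scope ring_scope.

Variable F : finFieldType.

Local Notation q := #|F|.

Lemma expf_card_pred (x : F) : x != 0 -> x ^+ q.-1 = 1.
Proof.
move=> x0; apply: (mulfI x0); rewrite mulr1 -exprS prednK ?expf_card //.
exact: ltnW (finNzRing_gt1 F).
Qed.

(** Translation by 1 permutes [F], so adding 1 to every element leaves the sum unchanged. *)
Lemma natr_card_eq0 : q%:R = 0 :> F.
Proof.
have /eqP : \sum_(x : F) x = \sum_(x : F) (x + 1).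
  rewrite (reindex_onto (fun x : F => x + 1) (fun x => x - 1)) /=.
    by apply: eq_bigl => x; rewrite addrK eqxx.
  by move=> x _; rewrite subrK.
by rewrite big_split /= -subr_eq0 opprD addrA subrr sub0r oppr_eq0 sumr_const
           => /eqP.
Qed.

(** Multiplication by [c] permutes [F] and scales the sum by [c ^+ k]. Some nonzero [c] has
    [c ^+ k != 1], since at most [k < q - 1] elements are [k]-th roots of unity. The case [k = 0] is
    a sum of [q] ones. *)
Lemma sum_expr_lt (k : nat) : (k < q.-1)%N -> \sum_(x : F) x ^+ k = 0.
Proof.
case: (posnP k) => [->|k0] kq.
  by under eq_bigr do rewrite expr0; rewrite sumr_const natr_card_eq0.
have [c c0 ck] : exists2 c : F, c != 0 & c ^+ k != 1.
  apply/exists_inP; apply: contraLR kq; rewrite negb_exists_in -leqNgt.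
  move=> /forall_inP ck; rewrite -(cardC1 (0 : F)) cardE.
  apply: max_unity_roots => //; last exact: enum_uniq.
  apply/allP => x; rewrite mem_enum => x0; apply/unity_rootP.
  by apply/eqP; have := ck x x0; rewrite negbK.
have : \sum_(x : F) x ^+ k = c ^+ k * \sum_(x : F) x ^+ k.
  rewrite mulr_sumr (reindex_inj (mulfI c0)) /=.
  by apply: eq_bigr => x _; rewrite exprMn.
move/eqP; rewrite -subr_eq0 -{1}[\sum_x _]mul1r -mulrBl mulf_eq0 subr_eq0.
by rewrite eq_sym (negPf ck) => /eqP.
Qed.

Lemma sum_expr_card_pred : \sum_(x : F) x ^+ q.-1 = -1.
Proof.
have xE (x : F) : x ^+ q.-1 = 1 - (x == 0)%:R.
  case: eqVneq => [->|x0]; last by rewrite subr0 expf_card_pred.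
  have := finNzRing_gt1 F; case: #|F| => [|[|n]] // _.
  by rewrite subrr expr0n.
rewrite (eq_bigr _ (fun x _ => xE x)) sumrB sumr_const natr_card_eq0 sub0r.
by rewrite -natr_sum (bigD1 0) //= eqxx big1 => // x /negPf ->.
Qed.

Lemma sum_rV_monomial n (m : 'I_n -> nat) :
  \sum_(v : 'rV[F]_n) \prod_i v ord0 i ^+ m i = \prod_i \sum_(x : F) x ^+ m i.
Proof.
rewrite bigA_distr_bigA /= (reindex (fun f : {ffun 'I_n -> F} => \row_i f i)) /=.
  by apply: eq_bigr => f _; apply: eq_bigr => i _; rewrite mxE.
exists (fun v : 'rV[F]_n => [ffun i => v ord0 i]) => [f _|v _].
  by apply/ffunP => i; rewrite ffunE mxE.
by apply/rowP => i; rewrite mxE ffunE.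
Qed.

Lemma sum_rV_monomial_lt n (m : 'I_n -> nat) :
  (\sum_i m i < n * q.-1)%N -> \sum_(v : 'rV[F]_n) \prod_i v ord0 i ^+ m i = 0.
Proof.
move=> ltm; rewrite sum_rV_monomial.
have [i mi] : exists i, (m i < q.-1)%N.
  apply/existsP; apply: contraLR ltm; rewrite negb_exists -leqNgt => /forallP mq.
  rewrite -[n in (n * _)%N]card_ord -sum_nat_const; apply: leq_sum => i _.
  by rewrite leqNgt.
by rewrite (bigD1 i) //= sum_expr_lt // mul0r.
Qed.

Lemma sum_meval_lt n (p : {mpoly F[n]}) :
  (msize p <= n * q.-1)%N -> \sum_(v : 'rV[F]_n) p.@[v ord0] = 0.
Proof.
move=> szp; under eq_bigr do rewrite mevalE.
rewrite exchange_big /= big_seq big1 // => m pm.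
rewrite -mulr_sumr sum_rV_monomial_lt ?mulr0 //.
by rewrite -mdegE (leq_trans _ szp) // msize_mdeg_lt.
Qed.

(** The complementary monomial isolates one coefficient: a monomial [k] survives only if
    [k i >= m i] for all [i], and equal degrees then force [k = m]. Each variable contributes a
    factor -1. *)
Lemma sum_homog_monomial n d (p : {mpoly F[n]}) (m : 'X_{1..n}) :
    p \is d.-homog -> (forall i, m i <= q.-1)%N -> mdeg m = d ->
  \sum_(v : 'rV[F]_n) p.@[v ord0] * \prod_i v ord0 i ^+ (q.-1 - m i)
    = (-1) ^+ n * p@_m.
Proof.
move=> hp mq dm.
under eq_bigr do rewrite mevalE mulr_suml.
rewrite exchange_big /=.
have termE k : \sum_(v : 'rV[F]_n) p@_k * \prod_i v ord0 i ^+ k i *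
                  \prod_i v ord0 i ^+ (q.-1 - m i)
    = p@_k * \prod_i \sum_(x : F) x ^+ (k i + (q.-1 - m i)).
  rewrite -sum_rV_monomial mulr_sumr; apply: eq_bigr => v _.
  rewrite -mulrA -big_split; congr (_ * _).
  by apply: eq_bigr => i _; rewrite exprD.
rewrite (eq_bigr _ (fun k _ => termE k)).
have diag : p@_m * \prod_i \sum_(x : F) x ^+ (m i + (q.-1 - m i))
    = (-1) ^+ n * p@_m.
  rewrite mulrC; congr (_ * _); rewrite (eq_bigr (fun=> -1)).
    by rewrite prodr_const card_ord.
  by move=> i _; rewrite subnKC // sum_expr_card_pred.
have off k : k \in msupp p -> k != m ->
    p@_k * \prod_i \sum_(x : F) x ^+ (k i + (q.-1 - m i)) = 0.
  move=> pk nkm; have dk : mdeg k = d by apply: (dhomogP _ _ _ hp).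
  have [i ki] : exists i, (k i < m i)%N.
    apply/existsP; apply: contraNT nkm; rewrite negb_exists => /forallP km.
    have {}km i : (m i <= k i)%N by rewrite leqNgt.
    apply/eqP/mnmP => i; apply/eqP; rewrite eqn_leq km andbT.
    move: dk; rewrite -dm !mdegE (bigD1 i) //= [in RHS](bigD1 i) //= => dE.
    rewrite -(leq_add2r (\sum_(j < n | j != i) m j)) -dE leq_add2l.
    by apply: leq_sum.
  rewrite (bigD1 i) //= sum_expr_lt ?mul0r ?mulr0 //.
  by move: ki (mq i); move: (k i) (m i) q.-1 => a b c; lia.
case: (boolP (m \in msupp p)) => [pm|pm].
  rewrite (bigD1_seq m) ?msupp_uniq //= diag big_seq_cond big1 ?addr0 //.
  by move=> k /andP[pk km]; apply: off.
rewrite (memN_msupp_eq0 pm) mulr0 big_seq big1 // => k pk; apply: off => //.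
by apply: contraNneq pm => <-.
Qed.

(** Coefficients of monomials with all exponents at most [q - 1] are isolated by
    [sum_homog_monomial]. In degree [q] the only others are the pure powers, whose coefficients are
    the values at the basis vectors. *)
Lemma homog_card_eq0 n (p : {mpoly F[n]}) :
  p \is q.-homog -> (forall v : 'rV[F]_n, p.@[v ord0] = 0) -> p = 0.
Proof.
move=> hp p0; apply/mpolyP => m; rewrite mcoeff0.
have q1 := finNzRing_gt1 F.
case: (eqVneq (mdeg m) q) => [dm|]; last exact: dhomog_nemf_coeff.
case: (boolP [forall i, m i <= q.-1]%N) => [/forallP mq|].
  apply/eqP; have := sum_homog_monomial hp mq dm.
  rewrite big1 => [|v _]; last by rewrite p0 mul0r.
  by move/esym/eqP; rewrite mulf_eq0 signr_eq0.
rewrite negb_forall => /existsP[i mi].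
have mE : m = (U_(i) *+ q)%MM.
  move: dm; rewrite mdegE (bigD1 i) //= => dm.
  have mq : m i = q.
    by move: mi dm q1; rewrite -ltnNge; move: (m i) q (bigop _ _ _) => a b c; lia.
  apply/mnmP => j; rewrite mulmnE mnm1E; case: eqVneq => [<-|ij]; first by rewrite mul1n.
  have /eqP : (\sum_(j < n | j != i) m j = 0)%N.
    by move: dm; rewrite mq -[RHS]addn0 => /addnI.
  by rewrite sum_nat_eq0 mul0n => /forall_inP /(_ j); rewrite eq_sym ij => /(_ isT) /eqP.
have := p0 (\row_j (j == i)%:R); rewrite mevalE.
have evE k : mdeg k = q ->
    \prod_j (\row_j0 (j0 == i)%:R : 'rV[F]_n) ord0 j ^+ k j = (k == m)%:R.
  move=> dk; case: (eqVneq k m) => [->|km].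
    rewrite big1 // => j _; rewrite mxE mE mulmnE mnm1E [i == j]eq_sym.
    by case: eqP => _; rewrite ?expr1n ?mul0n ?expr0.
  have [j ji kj] : exists2 j, j != i & k j != 0%N.
    apply/exists_inP; apply: contraNT km; rewrite negb_exists_in => /forall_inP k0.
    have {}k0 j : j != i -> k j = 0%N by move=> /k0; rewrite negbK => /eqP.
    apply/eqP/mnmP => j; rewrite mE mulmnE mnm1E.
    case: (eqVneq i j) => [<-|ij]; last by rewrite k0 1?eq_sym.
    by move: dk; rewrite mdegE (bigD1 i) //= big1 ?addn0 ?mul1n.
  by rewrite (bigD1 j) //= mxE (negPf ji) expr0n (negPf kj) mul0r.
rewrite big_seq (eq_bigr (fun k => p@_k * (k == m)%:R)) => [|k pk]; last first.
  by rewrite evE //; apply: (dhomogP _ _ _ hp).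
case: (boolP (m \in msupp p)) => [pm|pm]; last by rewrite (memN_msupp_eq0 pm).
rewrite -big_seq (bigD1_seq m) ?msupp_uniq //= eqxx mulr1 big1 ?addr0 //.
by move=> k /negPf ->; rewrite mulr0.
Qed.

End PowerSums.

(** * Homogeneous polynomials, linear forms and congruences between polynomials *)

Section Homogeneous.

Local Open Scope ring_scope.

Lemma homog_bigprod n (R : comNzRingType) (I : Type) (r : seq I) (d : I -> nat)
    (p : I -> {mpoly R[n]}) :
  (forall i, p i \is (d i).-homog) ->
  \prod_(i <- r) p i \is (\sum_(i <- r) d i).-homog.
Proof.
move=> hp; elim/big_rec2: _ => [|i k x _ hx]; first exact: dhomog1.
exact: dhomogM.
Qed.

Lemma homog_comp n k d (R : comNzRingType) (p : {mpoly R[n]})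
    (t : n.-tuple {mpoly R[k]}) :
  p \is d.-homog -> (forall i, tnth t i \is 1.-homog) -> p \mPo t \is d.-homog.
Proof.
move=> hp ht; rewrite comp_mpolyEX big_seq; apply: rpred_sum => m pm.
rewrite comp_mpolyX; apply: dhomogZ.
have <- : mdeg m = d by apply: (dhomogP _ _ _ hp).
rewrite mdegE; apply: homog_bigprod => i.
by rewrite -[X in X.-homog]mul1n dhomogMn.
Qed.

Lemma homog_mevalZ n d (R : comNzRingType) (p : {mpoly R[n]}) (c : R)
    (v : 'rV[R]_n) :
  p \is d.-homog -> p.@[(c *: v) ord0] = c ^+ d * p.@[v ord0].
Proof.
move=> hp; rewrite !mevalE mulr_sumr !big_seq; apply: eq_bigr => m pm.
have <- : mdeg m = d by apply: (dhomogP _ _ _ hp).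
rewrite mulrCA mdegE -prodrXr -big_split /=.
by congr (_ * _); apply: eq_bigr => i _; rewrite mxE exprMn.
Qed.

Lemma homog_msize_le n d (R : nzRingType) (p : {mpoly R[n]}) :
  p \is d.-homog -> (msize p <= d.+1)%N.
Proof.
move=> hp; rewrite msizeE; apply/bigmax_leqP_seq => m pm _.
by rewrite ltnS leq_eqVlt (dhomogP _ _ _ hp _ pm) eqxx.
Qed.

(** Lines are represented by coefficient vectors, so that points and lines share one type and the
    cross product serves for both. *)
Definition lin (R : nzRingType) (a : 'rV[R]_3) : {mpoly R[3]} :=
  \sum_(j < 3) a ord0 j *: 'X_j.

Definition dot (R : nzRingType) (a v : 'rV[R]_3) : R :=
  \sum_(j < 3) a ord0 j * v ord0 j.

Lemma meval_lin (R : comNzRingType) (a : 'rV[R]_3) (v : 'I_3 -> R) :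
  (lin a).@[v] = \sum_(j < 3) a ord0 j * v j.
Proof.
by rewrite /lin raddf_sum; apply: eq_bigr => j _; rewrite /= mevalZ mevalXU.
Qed.

Lemma lin_homog (R : comNzRingType) (a : 'rV[R]_3) : lin a \is 1.-homog.
Proof.
apply: rpred_sum => j _; apply: dhomogZ.
by rewrite dhomogX /= mdeg1.
Qed.

Lemma msize_lin (F : fieldType) (a : 'rV[F]_3) : a != 0 -> msize (lin a) = 2%N.
Proof.
move=> a0; apply/eqP; rewrite eqn_leq homog_msize_le ?lin_homog //=.
have /rV0Pn[j aj] := a0; apply: (@leq_trans (mdeg U_(j)).+1); first by rewrite mdeg1.
apply: msize_mdeg_lt; rewrite mcoeff_msupp /lin raddf_sum /=.
rewrite (bigD1 j) //= mcoeffZ mcoeffXU eqxx mulr1 big1 ?addr0 //.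
by move=> i /negPf ij; rewrite mcoeffZ mcoeffXU ij mulr0.
Qed.

Lemma prod_congr (R : comNzRingType) (a : R) (I : Type) (r : seq I) (x y : I -> R) :
  (forall i, exists g, x i - y i = a * g) ->
  exists g, \prod_(i <- r) x i - \prod_(i <- r) y i = a * g.
Proof.
move=> xy; elim/big_rec2: _ => [|i u v _ [g uv]].
  by exists 0; rewrite subrr mulr0.
have [h xyi] := xy i; exists (h * v + y i * g).
by rewrite mulrDr mulrA -xyi mulrCA -uv; ring.
Qed.

(** Congruence modulo the ideal of [a] respects sums and products, so it passes from the variables
    to [p]. *)
Lemma comp_congr n (R : comNzRingType) (a : {mpoly R[n]}) (p : {mpoly R[n]})
    (t : n.-tuple {mpoly R[n]}) :
  (forall i, exists g, 'X_i - tnth t i = a * g) -> exists g, p - (p \mPo t) = a * g.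
Proof.
move=> ht; elim/mpolyind: p => [|c m p _ _ [g hg]].
  by exists 0; rewrite comp_mpoly0 subrr mulr0.
have [h hh] : exists h, 'X_[m] - ('X_[m] \mPo t) = a * h.
  rewrite comp_mpolyX mpolyXE_id; apply: prod_congr => i.
  by have [u hu] := ht i; rewrite subrXX hu -mulrA; eexists.
exists (c *: h + g).
rewrite comp_mpolyD comp_mpolyZ mulrDr -scalerAr -hh -hg scalerBr opprD.
by rewrite addrACA.
Qed.

End Homogeneous.

(** * Forms of degree [q]: vanishing on a line, and the covering principle *)

Section FiniteField.

Local Open Scope ring_scope.

Variable F : finFieldType.
Local Notation q := #|F|.
Local Notation V := 'rV[F]_3.

(** Eliminating one variable by the equation of the line changes [p] by a multiple of [lin a] and
    leaves a form of degree [q] that vanishes at every vector, hence is zero. *)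
Lemma homog_vanish_line (p : {mpoly F[3]}) (a : V) :
    p \is q.-homog -> a != 0 ->
    (forall v : V, dot a v = 0 -> p.@[v ord0] = 0) ->
  exists g, p = lin a * g.
Proof.
move=> hp /rV0Pn[j aj] p0.
pose s : {mpoly F[3]} := 'X_j - (a ord0 j)^-1 *: lin a.
pose t := [tuple if i == j then s else 'X_i | i < 3].
have [g hg] : exists g, p - (p \mPo t) = lin a * g.
  apply: comp_congr => i; rewrite tnth_mktuple; case: eqP => [->|_].
    by exists (a ord0 j)^-1%:MP; rewrite opprB addrC subrK mulrC mul_mpolyC.
  by exists 0; rewrite subrr mulr0.
suff p't : p \mPo t = 0 by exists g; rewrite -hg p't subr0.
apply: homog_card_eq0.
  apply: homog_comp => // i; rewrite tnth_mktuple.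
  have hX k : ('X_k : {mpoly F[3]}) \is 1.-homog by rewrite dhomogX /= mdeg1.
  by case: eqP => // _; rewrite rpredB // dhomogZ // lin_homog.
move=> v; rewrite comp_mpoly_meval.
(* [w] is the projection of [v] to the line along the [j]-th axis; its coordinates are the values of
   [t] at [v]. *)
pose w : V := v - ((a ord0 j)^-1 * dot a v) *: delta_mx 0 j.
rewrite -(p0 w); last first.
  rewrite /dot /w; under eq_bigr do rewrite !mxE mulrBr.
  rewrite sumrB -/(dot a v) (bigD1 j) //= big1.
    by rewrite !eqxx mulr1 addr0 mulVKf // subrr.
  by move=> i /negPf ij; rewrite ij !mulr0.
apply: meval_eq => i; rewrite tnth_mktuple /w !mxE eqxx /=.
case: eqP => [->|_]; last by rewrite mevalXU mulr0 subr0.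
by rewrite mevalB mevalXU mevalZ meval_lin mulr1.
Qed.

Lemma sum_homog_lin (p : {mpoly F[3]}) (s : seq V) :
    p \is q.-homog -> size s = (q - 2)%N ->
  \sum_(v : V) p.@[v ord0] * \prod_(a <- s) dot a v = 0.
Proof.
move=> hp szs; pose g := \prod_(a <- s) lin a.
have hg : g \is (q - 2).-homog.
  rewrite -szs -sum1_size; apply: homog_bigprod => a; exact: lin_homog.
rewrite -[RHS](@sum_meval_lt F 3 (p * g)).
  apply: eq_bigr => v _; rewrite mevalM; congr (_ * _).
  by rewrite rmorph_prod; apply: eq_bigr => a _; rewrite /= meval_lin.
apply: leq_trans (homog_msize_le (dhomogM hp hg)) _.
by have := finNzRing_gt1 F; move: q => k; lia.
Qed.

Lemma dot_nondeg (a : V) : a != 0 -> exists u, dot a u != 0.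
Proof.
move=> /rV0Pn[j aj]; exists (delta_mx 0 j).
rewrite /dot (bigD1 j) //= !mxE !eqxx mulr1 big1 ?addr0 // => i /negPf ij.
by rewrite !mxE ij andbF mulr0.
Qed.

Lemma dotC (R : comNzRingType) (a v : 'rV[R]_3) : dot a v = dot v a.
Proof. by apply: eq_bigr => j _; rewrite mulrC. Qed.

Lemma dotZr (R : comNzRingType) (a v : 'rV[R]_3) c : dot a (c *: v) = c * dot a v.
Proof. by rewrite /dot mulr_sumr; apply: eq_bigr => j _; rewrite mxE mulrCA. Qed.

(* The points where [p] does not vanish, except that of [P], cannot be covered
   by [q - 2] lines avoiding [P]. *)
Lemma homog_eq0_cover (p : {mpoly F[3]}) (P : V) (s : seq V) :
    p \is q.-homog -> (size s <= q - 2)%N -> P != 0 ->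
    (forall a, a \in s -> dot a P != 0) ->
    (forall v : V, p.@[v ord0] != 0 -> (forall a, a \in s -> dot a v != 0) ->
       exists c, v = c *: P) ->
  p.@[P ord0] = 0.
Proof.
move=> hp szs P0 sP cov; have q1 := finNzRing_gt1 F.
have [w wP] : exists w, dot w P != 0.
  by have [w] := dot_nondeg P0; exists w; rewrite dotC.
(* Repeating a line [w] off [P] brings the number of forms to exactly [q - 2], so that the degree of
   the product is [2 (q - 1)]. *)
pose t := s ++ nseq (q - 2 - size s) w.
have tP a : a \in t -> dot a P != 0.
  by rewrite mem_cat => /orP[/sP //|]; rewrite mem_nseq => /andP[_ /eqP->].
have := @sum_homog_lin p t hp; rewrite size_cat size_nseq subnKC // => /(_ erefl).
pose h (v : V) := p.@[v ord0] * \prod_(a <- t) dot a v.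
have hZ (c : F) : c != 0 -> h (c *: P) = h P.
  move=> c0; rewrite /h (homog_mevalZ _ _ hp); under eq_bigr do rewrite dotZr.
  rewrite big_split /= big_const_seq count_predT -Monoid.iteropE -/(_ ^+ _) size_cat size_nseq subnKC //.
  rewrite mulrACA -exprD.
  have -> : (q + (q - 2) = q.-1 * 2)%N by move: q q1 => k; lia.
  by rewrite exprM expf_card_pred // expr1n mul1r.
rewrite -/(\sum_v h v) (bigID (mem [set c *: P | c : F & c != 0])) /=.
rewrite [X in _ + X]big1 => [|v vP]; last first.
  apply/eqP; apply: contraNT vP => hv.
  have pv : p.@[v ord0] != 0 by apply: contraNneq hv => pv; rewrite /h pv mul0r.
  have sv a : a \in s -> dot a v != 0.
    move=> sa; apply: contraNneq hv => av; rewrite /h (big_rem a) /=.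
      by rewrite av mul0r mulr0.
    by rewrite mem_cat sa.
  have [c vc] := cov v pv sv; apply/imsetP; exists c => //; rewrite inE.
  apply: contraNneq pv => c0; rewrite vc c0 (homog_mevalZ _ _ hp) expr0n.
  by case: q q1 => // k _; rewrite mul0r.
rewrite addr0 big_imset /=; last first.
  by move=> c d _ _ /eqP; rewrite -subr_eq0 -scalerBl scaler_eq0 (negPf P0) orbF subr_eq0 => /eqP.
rewrite (eq_bigr (fun=> h P)) => [|c]; last by rewrite inE => /hZ.
rewrite sumr_const -mulr_natl.
(* The number of nonzero scalars is -1 in [F], so the vanishing sum is [- h P]. *)
have -> : #|[set c : F | c != 0]|%:R = -1 :> F.
  rewrite -(sum_expr_card_pred F) (bigID (fun x => x == 0)) /= big_pred1_eq.
  rewrite expr0n -[_ == 0%N]negbK -lt0n; have -> : (0 < q.-1)%N by move: q q1 => k; lia.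
  rewrite add0r (eq_bigr (fun=> 1)) => [|x x0]; last exact: expf_card_pred.
  by rewrite sumr_const; congr (_%:R); apply: eq_card => x; rewrite inE.
rewrite mulN1r => /eqP; rewrite oppr_eq0 mulf_eq0 prodf_seq_eq0 => /orP[/eqP//|].
by case/hasP => a /tP aP /=; rewrite (negPf aP).
Qed.

End FiniteField.

(** * The projective plane *)

Section CrossProduct.

Local Open Scope ring_scope.

Lemma sum_ord3 (R : nmodType) (f : 'I_3 -> R) : \sum_(j < 3) f j = f 0 + f 1 + f 2.
Proof.
rewrite !big_ord_recl big_ord0 addr0 addrA.
by congr (f _ + f _ + f _); apply: val_inj.
Qed.

Lemma ord3P (P : 'I_3 -> Prop) : P 0 -> P 1 -> P 2 -> forall i, P i.
Proof.
move=> P0 P1 P2 [[|[|[|//]]] h].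
- by have -> : Ordinal h = 0 by apply: val_inj.
- by have -> : Ordinal h = 1 by apply: val_inj.
by have -> : Ordinal h = 2 by apply: val_inj.
Qed.

Variable F : fieldType.
Local Notation V := 'rV[F]_3.

Lemma row3P (v w : V) :
  v ord0 0 = w ord0 0 -> v ord0 1 = w ord0 1 -> v ord0 2 = w ord0 2 -> v = w.
Proof. by move=> *; apply/rowP; apply: ord3P. Qed.

Definition row3 (x y z : F) : V := \row_j [:: x; y; z]`_j.

Lemma row3E x y z : (row3 x y z ord0 0 = x) * (row3 x y z ord0 1 = y) *
  (row3 x y z ord0 2 = z).
Proof. by rewrite !mxE. Qed.

Lemma dotE (a v : V) :
  dot a v = a ord0 0 * v ord0 0 + a ord0 1 * v ord0 1 + a ord0 2 * v ord0 2.
Proof. exact: sum_ord3. Qed.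

(** The cross product: the line through two points, or the common point of two lines.
    [dot (crs a b) c] is the determinant of the three vectors. *)
Definition crs (a b : V) : V :=
  row3 (a ord0 1 * b ord0 2 - a ord0 2 * b ord0 1)
       (a ord0 2 * b ord0 0 - a ord0 0 * b ord0 2)
       (a ord0 0 * b ord0 1 - a ord0 1 * b ord0 0).

Lemma crsE (a b : V) :
  (crs a b ord0 0 = a ord0 1 * b ord0 2 - a ord0 2 * b ord0 1) *
  (crs a b ord0 1 = a ord0 2 * b ord0 0 - a ord0 0 * b ord0 2) *
  (crs a b ord0 2 = a ord0 0 * b ord0 1 - a ord0 1 * b ord0 0).
Proof. by rewrite !row3E. Qed.

Ltac vring := rewrite ?dotE; try apply: row3P; rewrite ?(crsE, mxE, dotE, row3E); ring.

Lemma dotDr (a v w : V) : dot a (v + w) = dot a v + dot a w.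
Proof. vring. Qed.

Lemma dotDl (a b v : V) : dot (a + b) v = dot a v + dot b v.
Proof. vring. Qed.

Lemma dotNr (a v : V) : dot a (- v) = - dot a v.
Proof. vring. Qed.

Lemma dotZl (a v : V) c : dot (c *: a) v = c * dot a v.
Proof. vring. Qed.

Lemma dot_crsl (a b : V) : dot (crs a b) a = 0.
Proof. vring. Qed.

Lemma dot_crsr (a b : V) : dot (crs a b) b = 0.
Proof. vring. Qed.

Lemma dot_crsC (a b c : V) : dot (crs a b) c = dot (crs b c) a.
Proof. vring. Qed.

Lemma crsC (a b : V) : crs a b = - crs b a.
Proof. vring. Qed.

Lemma crsvv (a : V) : crs a a = 0.
Proof. vring. Qed.

Lemma crsZl c (a b : V) : crs (c *: a) b = c *: crs a b.
Proof. vring. Qed.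

Lemma crsZr c (a b : V) : crs a (c *: b) = c *: crs a b.
Proof. vring. Qed.

Lemma crsDr (a b c : V) : crs a (b + c) = crs a b + crs a c.
Proof. vring. Qed.

(** For the line [a] and points [x], [y], this vector represents the point where [a] meets the line
    [x y]. *)
Lemma crs_crs (a x y : V) : crs a (crs x y) = dot a y *: x - dot a x *: y.
Proof. vring. Qed.

Lemma cramer (x y w v : V) :
  dot (crs x y) w *: v =
    dot (crs y w) v *: x + dot (crs w x) v *: y + dot (crs x y) v *: w.
Proof. vring. Qed.

Lemma crs_eq0 (a b : V) : crs a b = 0 -> b != 0 -> exists c, a = c *: b.
Proof.
move=> ab /rV0Pn[j bj]; exists (a ord0 j / b ord0 j).
(* The triple product with a basis vector reads [b_j a - a_j b = 0]. *)
have := crs_crs (delta_mx 0 j) a b; rewrite ab.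
have dj (v : V) : dot (delta_mx 0 j) v = v ord0 j.
  rewrite /dot (bigD1 j) //= !mxE !eqxx mul1r big1 ?addr0 // => i /negPf ij.
  by rewrite mxE ij mul0r.
have -> : crs (delta_mx 0 j) 0 = 0 by vring.
rewrite !dj => /esym/eqP; rewrite subr_eq0 => /eqP abj.
by apply: (scalerI bj); rewrite abj scalerA mulrCA divff // mulr1.
Qed.

Lemma crs_neq0 (a b u : V) : dot a u = 0 -> dot b u != 0 -> a != 0 -> crs a b != 0.
Proof.
move=> au bu a0; apply: contraNneq bu => ab.
have [|c ->] := @crs_eq0 b a _ a0; first by rewrite crsC ab oppr0.
by rewrite dotZl au mulr0.
Qed.

Lemma crs_span (x y v : V) : crs x y != 0 -> dot (crs x y) v = 0 ->
  exists s t, v = s *: x + t *: y.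
Proof.
move=> xy xyv; have /rV0Pn[j cj] := xy.
pose w : V := delta_mx 0 j.
have dw : dot (crs x y) w != 0.
  rewrite /dot (bigD1 j) //= [w _ _]mxE !eqxx mulr1 big1 ?addr0 // => i /negPf ij.
  by rewrite [w _ _]mxE ij mulr0.
exists (dot (crs y w) v / dot (crs x y) w), (dot (crs w x) v / dot (crs x y) w).
apply: (scalerI dw); rewrite cramer xyv scale0r addr0 scalerDr !scalerA.
by rewrite !(mulrCA (dot (crs x y) w)) divff // !mulr1.
Qed.

Lemma crs_span_perp (x y a : V) : crs x y != 0 -> dot x a = 0 -> dot y a = 0 ->
  exists c, a = c *: crs x y.
Proof.
move=> xy xa ya; apply: crs_eq0 => //.
by rewrite crs_crs ![dot a _]dotC xa ya !scale0r subrr.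
Qed.

End CrossProduct.

(** * Normalised representatives of the points of the plane *)

Section ProjectivePlane.

Local Open Scope ring_scope.

Variable F : finFieldType.
Local Notation q := #|F|.
Local Notation V := 'rV[F]_3.

(** The choice depends only on the class of [v], and the default 0 is never reached because [v] lies
    in its own class. Counting these representatives replaces sets of sets by sets of vectors. *)
Definition nrm (v : V) : V := odflt 0 [pick w in proj_point v].

Definition pts : {set V} := [set v : V | (v != 0) && (nrm v == v)].

Lemma nrm_scale (v : V) : exists2 c, c != 0 & nrm v = c *: v.
Proof.
rewrite /nrm; case: pickP => [w /imsetP[c]|/(_ v)/negP[]].
  by rewrite inE => c0 ->; exists c.
by apply/imsetP; exists 1; rewrite ?inE ?oner_eq0 // scale1r.
Qed.

Lemma proj_pointZ c (v : V) : c != 0 -> proj_point (c *: v) = proj_point v.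
Proof.
move=> c0; apply/setP => w; apply/imsetP/imsetP => -[b]; rewrite inE => b0 ->.
  by exists (b * c); rewrite ?inE ?mulf_neq0 // scalerA.
by exists (b / c); rewrite ?inE ?mulf_neq0 ?invr_eq0 // scalerA divfK.
Qed.

Lemma nrmZ c (v : V) : c != 0 -> nrm (c *: v) = nrm v.
Proof. by move=> c0; rewrite /nrm proj_pointZ. Qed.

Lemma nrm_pts (v : V) : v != 0 -> nrm v \in pts.
Proof.
move=> v0; rewrite inE; have [c c0 vE] := nrm_scale v.
by rewrite {2}vE nrmZ // eqxx andbT vE scaler_eq0 negb_or c0.
Qed.

Lemma pts_neq0 (v : V) : v \in pts -> v != 0.
Proof. by rewrite inE => /andP[]. Qed.

Lemma pts_nrm (v : V) : v \in pts -> nrm v = v.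
Proof. by rewrite inE => /andP[_ /eqP]. Qed.

Lemma pts_scale_inj (u v : V) c : u \in pts -> v \in pts -> u = c *: v -> u = v.
Proof.
move=> hu hv uv; rewrite -(pts_nrm hu) -(pts_nrm hv) uv nrmZ //.
by apply: contraNneq (pts_neq0 hu) => c0; rewrite uv c0 scale0r.
Qed.

Lemma pts_crs (u v : V) : u \in pts -> v \in pts -> u != v -> crs u v != 0.
Proof.
move=> hu hv; apply: contraNneq => /crs_eq0 /(_ (pts_neq0 hv))[c uv].
by apply/eqP; apply: (pts_scale_inj hu hv uv).
Qed.

(** Such a set is a union of classes of [q - 1] vectors each, so points can be counted through
    vectors. *)
Lemma card_scale_invariant (S : {set V}) :
    0 \notin S -> (forall c v, c != 0 -> v \in S -> c *: v \in S) ->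
  (#|S| = #|S :&: pts| * q.-1)%N.
Proof.
move=> S0 SZ; have -> : q.-1 = #|[set c : F | c != 0]|.
  by rewrite cardsE -(cardC1 (0 : F)).
rewrite mulnC -cardsX.
rewrite -[RHS](@card_in_imset _ _ (fun u => u.1 *: u.2)).
  apply: eq_card => v; apply/idP/imsetP => [Sv|[[c w]]].
    have v0 : v != 0 by apply: contraNneq S0 => <-.
    have [c c0 vE] := nrm_scale v; exists (c^-1, nrm v).
      rewrite !inE /= invr_eq0 c0 /=; have := nrm_pts v0; rewrite inE => ->.
      by rewrite vE SZ.
    by rewrite /= vE scalerA mulVf // scale1r.
  by rewrite !inE /= => /andP[c0 /andP[Sw _]] ->; rewrite SZ.
move=> [c v] [d w]; rewrite !inE /= => /andP[c0 /and3P[_ v0 /eqP hv]].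
move=> /andP[d0 /and3P[_ w0 /eqP hw]] cvdw.
have vw : v = w by rewrite -hv -hw -(nrmZ v c0) cvdw nrmZ.
move: cvdw => /eqP; rewrite vw -subr_eq0 -scalerBl scaler_eq0 (negPf w0) orbF.
by rewrite subr_eq0 => /eqP ->.
Qed.

Lemma num_pointsE (p : {mpoly F[3]}) d : p \is d.-homog ->
  num_points p = #|[set v in pts | p.@[v ord0] == 0]|.
Proof.
move=> hp; rewrite /num_points.
have -> : rational_points p = @proj_point F @: [set v in pts | p.@[v ord0] == 0].
  apply/setP => A; apply/imsetP/imsetP => -[v].
    rewrite inE => /andP[v0 pv] ->; exists (nrm v).
      rewrite inE nrm_pts //=; have [c _ ->] := nrm_scale v.
      by rewrite (homog_mevalZ _ _ hp) (eqP pv) mulr0.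
    by have [c c0 ->] := nrm_scale v; rewrite proj_pointZ.
  rewrite inE => /andP[hv pv] ->; exists v => //.
  by rewrite inE pv (pts_neq0 hv).
rewrite card_in_imset // => u v; rewrite !inE => /andP[/andP[_ /eqP hu] _].
by move=> /andP[/andP[_ /eqP hv] _] uv; rewrite -hu -hv /nrm uv.
Qed.

End ProjectivePlane.

(** * Double counting of the incidences between a set of points and the lines *)

Section Secants.

Local Open Scope ring_scope.

Variable F : finFieldType.
Local Notation q := #|F|.
Local Notation V := 'rV[F]_3.

(** The fibres of [dot _ x] are translates of each other, so each has [q ^ 3 / q] elements. *)
Lemma card_perp (x : V) : x != 0 -> #|[set a : V | dot a x == 0]| = (q ^ 2)%N.
Proof.
move=> x0; have [w0 dw0] := dot_nondeg x0; rewrite dotC in dw0.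
pose w := (dot w0 x)^-1 *: w0.
have dw : dot w x = 1 by rewrite dotZl mulVf.
have fiber t : #|[set a : V | dot a x == t]| = #|[set a : V | dot a x == 0]|.
  rewrite -[RHS](card_imset _ (addIr (t *: w))); apply: eq_card => a.
  rewrite inE; apply/eqP/imsetP => [ax|[b]].
    exists (a - t *: w); last by rewrite subrK.
    by rewrite inE -scaleNr dotDl dotZl dw ax mulr1 subrr.
  by rewrite inE => /eqP bx ->; rewrite dotDl dotZl dw bx mulr1 add0r.
have : #|V| = (\sum_(t : F) #|[set a : V | dot a x == t]|)%N.
  rewrite -sum1_card (partition_big (fun a => dot a x) predT) //=.
  by apply: eq_bigr => t _; rewrite -sum1_card; apply: eq_bigl => a; rewrite !inE.
rewrite (eq_bigr _ (fun t _ => fiber t)) sum_nat_const card_mx mul1n -[3%N]/(2.+1).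
rewrite expnS => /eqP; rewrite eqn_pmul2l; first by move/eqP->.
exact: ltnW (finNzRing_gt1 F).
Qed.

Lemma card_perp2 (x y : V) : crs x y != 0 ->
  #|[set a : V | (dot a x == 0) && (dot a y == 0)]| = q.
Proof.
move=> xy; have inj : injective (fun c : F => c *: crs x y).
  move=> c d /eqP; rewrite -subr_eq0 -scalerBl scaler_eq0 (negPf xy) orbF.
  by rewrite subr_eq0 => /eqP.
rewrite -(card_imset predT inj); apply: eq_card => a; rewrite inE.
apply/andP/imsetP => [[/eqP ax /eqP ay]|[c _ ->]].
  have [||c ->] := @crs_span_perp _ x y a xy; rewrite 1?dotC //.
  by exists c.
by rewrite !dotZl dot_crsl dot_crsr !mulr0.
Qed.

(** Sums of [sec] run over coefficient vectors: every line occurs [q - 1] times, and the zero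
    vector, which counts all of [B], has to be split off. *)
Definition sec (B : {set V}) (a : V) : nat := #|[set x in B | dot a x == 0]|.

Lemma secE B a : sec B a = (\sum_(x in B) (dot a x == 0%R))%N.
Proof.
rewrite /sec -sum1_card big_mkcond [RHS]big_mkcond /=; apply: eq_bigr => x _.
by rewrite inE; case: (x \in B); case: eqP.
Qed.

Lemma sum_bool_card (P : pred V) : (\sum_(a : V) P a)%N = #|[set a | P a]|.
Proof.
rewrite -sum1_card [RHS]big_mkcond; apply: eq_bigr => a _.
by rewrite inE; case: (P a).
Qed.

Lemma sec0 B : sec B 0 = #|B|.
Proof.
apply: eq_card => x; rewrite inE /dot big1 ?eqxx ?andbT // => i _.
by rewrite mxE mul0r.
Qed.

Lemma sum_sec (B : {set V}) : B \subset pts F ->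
  (\sum_(a : V | a != 0%R) sec B a + #|B| = #|B| * q ^ 2)%N.
Proof.
move=> /subsetP Bp; have : (\sum_(a : V) sec B a = #|B| * q ^ 2)%N.
  under eq_bigr do rewrite secE.
  rewrite exchange_big /= -sum_nat_const; apply: eq_bigr => x /Bp/pts_neq0 x0.
  by rewrite sum_bool_card card_perp.
by rewrite (bigD1 0) //= sec0 addnC.
Qed.

(** The square counts ordered pairs of points on the line: a pair of equal points is orthogonal to
    [q ^ 2] vectors, a pair of distinct points to [q]. *)
Lemma sum_sec_sq (B : {set V}) : B \subset pts F ->
  (\sum_(a : V | a != 0%R) sec B a ^ 2 + #|B| ^ 2 =
     #|B| * q ^ 2 + #|B| * #|B|.-1 * q)%N.
Proof.
move=> /subsetP Bp.
have : (\sum_(a : V) sec B a ^ 2 = #|B| * (q ^ 2 + #|B|.-1 * q))%N.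
  under eq_bigr do rewrite expnS expn1 secE big_distrl /=.
  rewrite exchange_big /= -sum_nat_const; apply: eq_bigr => x xB.
  under eq_bigr do rewrite big_distrr /=.
  rewrite exchange_big /= (bigD1 x) //=; congr (_ + _)%N.
    rewrite -(card_perp (pts_neq0 (Bp x xB))) -sum_bool_card.
    by apply: eq_bigr => a _; case: eqP.
  rewrite (eq_bigr (fun=> q)); last first.
    move=> y /andP[yB yx].
    rewrite -(@card_perp2 x y) -?sum_bool_card; last first.
      by rewrite pts_crs ?Bp // eq_sym.
    by apply: eq_bigr => a _; case: eqP; case: eqP.
  rewrite sum_nat_const; congr (_ * _)%N.
  rewrite [in RHS](cardD1 x) xB /=; apply: eq_card => y; rewrite !inE.
  by rewrite andbC.
by rewrite (bigD1 0) //= sec0 addnC mulnDr mulnA.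
Qed.

(* Otherwise [(n - 1) (n - s) <= 0] for the number [n] of points of [B] on any
   line; the standard equations turn the sum of these products into a quadratic
   in [#|B|] that is negative at no point. *)
Lemma exists_secant (B : {set V}) (s : nat) : B \subset pts F ->
    (forall a : V, a != 0%R -> 0 < sec B a)%N ->
    (s = 2 \/ s = 3 /\ 5 <= q)%N ->
  exists2 a, a != 0 & (s < sec B a)%N.
Proof.
move=> Bp Bblock sq; apply/exists_inP; apply: contraT.
rewrite negb_exists_in => /forall_inP small.
have : (\sum_(a : V | a != 0%R) (sec B a ^ 2 + s) <=
        \sum_(a : V | a != 0%R) s.+1 * sec B a)%N.
  apply: leq_sum => a a0; have := small a a0; have := Bblock a a0.
  by rewrite -leqNgt; case: sq => [->|[-> _]]; move: (sec B a); nia.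
rewrite big_split /= sum_nat_const -big_distrr /=.
have -> : #|[pred a : V | a != 0]| = (q ^ 3 - 1)%N.
  by rewrite (cardC1 (0 : V)) card_mx mul1n subn1.
have := sum_sec Bp; have := sum_sec_sq Bp.
move: (bigop _ _ _) (bigop _ _ _) => S1 S2.
have := finNzRing_gt1 F.
move: sq; move: q #|B| => k b sq k1 h1 h2 h3.
exfalso.
(* [K = q - 1], the number of coefficient vectors of one line, is a factor of both sides. *)
have [K kE] : exists K, k = K.+1 by exists k.-1; lia.
have {h3}h3 : (S2 + s * (k ^ 3 - 1) <= s.+1 * S1)%N by rewrite [(s * _)%N]mulnC.
have bE : (b * b.-1 + b = b ^ 2)%N by case: (b) => [|b'] //=; rewrite -mulnSr.
have {h3}h3 : (K * (b ^ 2 + s * (k ^ 2 + k + 1)) <= K * (b + s * b * k.+1))%N by subst k; nia.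
have {h3} : (b ^ 2 + s * (k ^ 2 + k + 1) <= b + s * b * k.+1)%N.
  by rewrite leq_pmul2l in h3; lia.
(* The square is completed. The discriminants in [b] are [-4 k^2 + 4 k + 1] for [s = 2] and
   [-3 k^2 + 12 k + 4] for [s = 3], negative for [k >= 2] and [k >= 5] respectively. *)
clear h1 h2 kE; case: sq => [->|[-> k5]].
  by have [+ _] := nat_Cauchy (2 * b) (2 * k + 3); nia.
by have [+ _] := nat_Cauchy (2 * b) (3 * k + 4); nia.
Qed.

End Secants.

(** * Covering points by lines that avoid a given point *)

Section Covering.

Local Open Scope ring_scope.

Variable F : finFieldType.
Local Notation q := #|F|.
Local Notation V := 'rV[F]_3.

Lemma line_avoiding (P x : V) : crs P x != 0 ->
  exists a, dot a P != 0 /\ dot a x = 0.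
Proof.
move=> /dot_nondeg[u Pxu]; exists (crs x u).
by rewrite -dot_crsC dot_crsl.
Qed.

Lemma cover_points (P : V) (s : seq V) : (forall x, x \in s -> crs P x != 0) ->
  exists t : seq V, [/\ size t = size s, forall a, a \in t -> dot a P != 0 &
    forall x, x \in s -> exists2 a, a \in t & dot a x = 0].
Proof.
elim: s => [|x s IHs] Ps; first by exists [::].
have [|t [szt tP tx]] := IHs; first by move=> y ys; rewrite Ps // inE ys orbT.
have [|a [aP ax]] := @line_avoiding P x; first by rewrite Ps ?mem_head.
exists (a :: t); split=> [|b|y]; first by rewrite /= szt.
  by rewrite inE => /predU1P[->|/tP].
rewrite inE => /predU1P[->|/tx[b bt by0]]; first by exists a; rewrite ?mem_head.
by exists b; rewrite // inE bt orbT.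
Qed.

(* Sort the points by the line joining them to [P] and pair the point at
   position [i] with the one at position [i + k]. *)
Lemma cover_pairs (P : V) (s : seq V) (k : nat) :
    P != 0 -> (forall x, x \in s -> crs P x != 0) -> (size s <= 2 * k)%N ->
    (forall x, x \in s -> count (fun y => dot (crs P x) y == 0%R) s <= k)%N ->
  exists t : seq V, [/\ size t = k, forall a, a \in t -> dot a P != 0 &
    forall x, x \in s -> exists2 a, a \in t & dot a x = 0].
Proof.
move=> P0 Ps szs cs.
have [w wP] : exists w, dot w P != 0.
  by have [w] := dot_nondeg P0; exists w; rewrite dotC.
(* For points other than [P], equal keys mean collinear with [P]; a numerical key allows sorting. *)
pose key (x : V) : nat := enum_rank [set y | dot (crs P x) y == 0].
pose s' := sort (relpre key leq) s.
have mem_s' x : (x \in s') = (x \in s) by rewrite mem_sort.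
have sz' : size s' = size s by rewrite size_sort.
have key_col x y : key x = key y -> dot (crs P x) y = 0.
  move=> /ord_inj/enum_rank_inj/setP/(_ y); rewrite !inE dot_crsr eqxx.
  by move/eqP.
have col_key x y : crs P x != 0 -> crs P y != 0 -> dot (crs P x) y = 0 -> key x = key y.
  move=> Px Py xy; have [|c yE] := @crs_eq0 _ (crs P y) (crs P x) _ Px.
    by rewrite crsC crs_crs xy dot_crsl !scale0r subrr oppr0.
  rewrite /key; congr (nat_of_ord (enum_rank _)); apply/setP => z; rewrite !inE yE dotZl.
  rewrite mulf_eq0; case: (eqVneq c 0) => //= c0.
  by move: Py; rewrite yE c0 scale0r eqxx.
have pairs (i : 'I_k) : exists a, [/\ dot a P != 0,
    (i < size s -> dot a (nth P s' i) = 0%R)%N &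
    (i + k < size s -> dot a (nth P s' (i + k)) = 0%R)%N].
  case: (ltnP i (size s)) => [si|]; last first.
    by move=> si; exists w; split=> // sik; lia.
  have xs : nth P s' i \in s by rewrite -mem_s' mem_nth // sz'.
  case: (ltnP (i + k) (size s)) => [sik|_]; last first.
    by have [a [aP ax]] := line_avoiding (Ps _ xs); exists a.
  have ys : nth P s' (i + k) \in s by rewrite -mem_s' mem_nth // sz'.
  exists (crs (nth P s' i) (nth P s' (i + k))); rewrite dot_crsl dot_crsr.
  split=> //; rewrite -dot_crsC; apply/eqP => xy.
  have kxy := col_key _ _ (Ps _ xs) (Ps _ ys) xy.
  (* If the joining line contained [P], the keys at positions [i] and [i + k] would agree. By
     sortedness so would the keys in between, which puts [k + 1] points on one line through [P]. *)
  have := cs _ xs; rewrite leqNgt => /negP; apply.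
  have -> : count (fun y => dot (crs P (nth P s' i)) y == 0) s =
            count (fun y => dot (crs P (nth P s' i)) y == 0) s'.
    by apply/permP; rewrite perm_sym perm_sort.
  rewrite -[s'](cat_take_drop i) count_cat -[drop i s'](cat_take_drop k.+1) count_cat.
  set T := take k.+1 _; rewrite cat_take_drop cat_take_drop.
  have -> : count (fun y => dot (crs P (nth P s' i)) y == 0) T = k.+1.
    have szT : size T = k.+1 by rewrite size_takel // size_drop sz'; lia.
    rewrite -[RHS]szT; apply/eqP; rewrite -all_count; apply/(all_nthP P) => j.
    rewrite szT ltnS => jk; rewrite nth_take // nth_drop; apply/eqP/key_col.
    have tr : transitive (relpre key leq) by move=> ? ? ?; apply: leq_trans.
    have rf : reflexive (relpre key leq) by move=> ?; apply: leqnn.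
    have so : sorted (relpre key leq) s'.
      by apply: sort_sorted => ? ?; apply: leq_total.
    have mono := sorted_leq_nth tr rf P so.
    apply/eqP; rewrite eqn_leq; apply/andP; split.
      by apply: mono; rewrite ?inE ?sz' //; lia.
    by rewrite kxy; apply: mono; rewrite ?inE ?sz' //; lia.
  by rewrite addnCA; apply: leq_addr.
have [a ha] := fin_all_exists pairs.
exists (codom a); split=> [|b /codomP[i ->]|x xs]; first by rewrite size_codom card_ord.
  by have [] := ha i.
have xi : (index x s' < size s)%N by rewrite -sz' index_mem mem_s'.
have xE : nth P s' (index x s') = x by rewrite nth_index // mem_s'.
case: (ltnP (index x s') k) => ik.
  exists (a (Ordinal ik)); first exact: codom_f.
  by have [_ /(_ xi) <- _] := ha (Ordinal ik); rewrite xE.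
have ik' : (index x s' - k < k)%N by lia.
exists (a (Ordinal ik')); first exact: codom_f.
have [_ _] := ha (Ordinal ik'); rewrite /= subnK // xE; exact.
Qed.

End Covering.

(** * Curves with few nonzero points *)

Section BlockingCurve.

Local Open Scope ring_scope.

Variable F : finFieldType.
Local Notation q := #|F|.
Local Notation V := 'rV[F]_3.

Variable p : {mpoly F[3]}.

Definition nonzeros : {set V} := [set v in pts F | p.@[v ord0] != 0].

Local Notation B := nonzeros.

Definition off (a : V) : {set V} := [set v in B | dot a v != 0].

Hypothesis hp : p \is q.-homog.
Hypothesis blocking : forall a : V, a != 0 -> exists2 v, dot a v = 0 & p.@[v ord0] != 0.

Lemma nonzeros_sub : B \subset pts F.
Proof. by apply/subsetP => v; rewrite inE => /andP[]. Qed.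

Lemma nonzerosP (v : V) : v \in B -> (v \in pts F) /\ p.@[v ord0] != 0.
Proof. by rewrite inE => /andP[]. Qed.

Lemma offP (a v : V) : v \in off a -> [/\ v \in pts F, p.@[v ord0] != 0 & dot a v != 0].
Proof. by rewrite inE => /andP[/nonzerosP[]]. Qed.

Lemma homog_meval0 : p.@[(0 : V) ord0] = 0.
Proof.
rewrite -(scale0r 0) (homog_mevalZ _ _ hp) expr0n.
by case: q (finNzRing_gt1 F) => // k _; rewrite mul0r.
Qed.

Lemma nrm_nonzeros (v : V) : p.@[v ord0] != 0 ->
  nrm v \in B /\ exists2 c, c != 0 & nrm v = c *: v.
Proof.
move=> pv; have [c c0 vE] := nrm_scale v; split; last by exists c.
have v0 : v != 0 by apply: contraNneq pv => ->; rewrite homog_meval0.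
rewrite inE nrm_pts //= vE (homog_mevalZ _ _ hp) mulf_neq0 // expf_neq0 //.
Qed.

Lemma sec_gt0 (a : V) : a != 0 -> (0 < sec B a)%N.
Proof.
move=> /blocking[v av pv]; have [nB [c c0 vE]] := nrm_nonzeros pv.
by apply/card_gt0P; exists (nrm v); rewrite inE nB vE dotZr av mulr0 eqxx.
Qed.

Lemma card_off (a : V) : (sec B a + #|off a| = #|B|)%N.
Proof.
rewrite -(cardsID [set v | dot a v == 0] B); congr (_ + _)%N.
  by apply: eq_card => v; rewrite !inE.
by apply: eq_card => v; rewrite !inE andbC.
Qed.

(* Project from a point [R] of the line [a] that is not in [B]: each of the
   [q] other lines through [R] meets [B]. *)
Lemma off_projection (a R : V) :
    a != 0 -> R != 0 -> dot a R = 0 -> p.@[R ord0] = 0 ->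
  (q <= #|off a|)%N /\
  ((#|off a| <= q)%N -> {in off a &, forall u v, dot (crs R u) v = 0 -> u = v}).
Proof.
move=> a0 R0 aR pR.
have [u0 au0] := dot_nondeg a0.
(* [c] is a second line through [R], so the lines through [R] other than [a] are the [c + t *: a];
   [phi v] is the parameter [t] of the one that contains [v]. *)
pose c := crs R u0.
have acE : crs a c = dot a u0 *: R by rewrite crs_crs aR scale0r subr0.
have ac0 : crs a c != 0 by rewrite acE scaler_eq0 negb_or au0.
pose phi (v : V) := - (dot c v / dot a v).
have phi_onto : phi @: off a = [set: F].
  apply/setP => t; rewrite inE; apply/imsetP.
  have [|v vt pv] := blocking (a := c + t *: a).
    apply: contraNneq ac0 => ct; have := crsDr a c (t *: a).
    rewrite ct crsZr crsvv scaler0 addr0 => <-.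
    by apply/eqP; apply: row3P; rewrite !crsE !mxE; ring.
  have [nB [d d0 vE]] := nrm_nonzeros pv.
  rewrite dotDl dotZl in vt.
  have av : dot a v != 0.
    apply: contraNneq pv => av; rewrite av mulr0 addr0 in vt.
    have [|e ->] := @crs_span_perp _ a c v ac0 av; first by rewrite vt.
    by rewrite acE scalerA (homog_mevalZ _ _ hp) pR mulr0.
  exists (nrm v); first by rewrite inE nB vE dotZr mulf_neq0.
  rewrite /phi vE !dotZr -mulf_div divff // mul1r.
  move/eqP: vt; rewrite addr_eq0 => /eqP ->.
  by rewrite mulNr mulfK // opprK.
have card_phi : #|phi @: off a| = q by rewrite phi_onto cardsT.
split=> [|offq]; first by rewrite -card_phi leq_imset_card.
(* With only [q] points off [a], the surjection [phi] is injective: no line through [R] contains two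
   of them. *)
have /imset_injP phi_inj : #|phi @: off a| == #|off a|.
  by rewrite eqn_leq leq_imset_card card_phi.
move=> u v hu hv uv; apply: phi_inj => //.
have au : dot a u != 0 by move: hu; rewrite inE => /andP[].
have av : dot a v != 0 by move: hv; rewrite inE => /andP[].
have Ru : crs R u != 0 by apply: (@crs_neq0 _ R u a); rewrite 1?dotC // aR.
have [s [t vE]] := crs_span Ru uv.
have t0 : t != 0 by apply: contraNneq av => t0; rewrite vE t0 scale0r addr0 dotZr aR mulr0.
rewrite /phi vE !dotDr !dotZr aR dot_crsl !mulr0 !add0r.
by rewrite -[t * _ / _]mulf_div divff // mul1r.
Qed.

Lemma sec_full (a : V) : a != 0 ->
  (forall R : V, R != 0 -> dot a R = 0 -> p.@[R ord0] != 0) -> sec B a = q.+1.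
Proof.
move=> a0 full; pose S := [set v : V | (v != 0) && (dot a v == 0)].
have cS : (#|S| = sec B a * q.-1)%N.
  rewrite card_scale_invariant.
  - congr (_ * _)%N; apply: eq_card => v; rewrite !inE.
    case: (boolP (v != 0)) => //= v0; case: (eqVneq (dot a v) 0) => av; rewrite ?andbF //=.
    by rewrite full // !andbT.
  - by rewrite inE eqxx.
  move=> c v c0; rewrite !inE => /andP[v0 /eqP av].
  by rewrite scaler_eq0 negb_or c0 v0 dotZr av mulr0 /=.
have : (#|S| + 1 = q ^ 2)%N.
  rewrite -(card_perp a0) [RHS](cardsD1 0) inE.
  have -> : dot 0 a = 0 by rewrite -(scale0r 0) dotZl mul0r.
  rewrite eqxx addnC; congr (_ + _)%N; apply: eq_card => v; rewrite !inE.
  by rewrite dotC.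
rewrite cS; have := finNzRing_gt1 F; move: q (sec B a) => k n k1.
case: k k1 => // k k1 /= nk; apply/eqP; rewrite -(eqn_pmul2r (m := k)) //.
by apply/eqP; nia.
Qed.

Hypothesis small : (#|B| <= 2 * q - 1)%N.

Lemma off_ge (a : V) : a != 0 ->
  [\/ (q <= #|off a|)%N | forall R : V, R != 0 -> dot a R = 0 -> p.@[R ord0] != 0].
Proof.
move=> a0; case: (boolP [exists R : V, [&& R != 0, dot a R == 0 & p.@[R ord0] == 0]]).
  case/existsP => R /and3P[R0 /eqP aR /eqP pR].
  by left; have [] := off_projection a0 R0 aR pR.
rewrite negb_exists => /forallP noR; right=> R R0 aR; apply/negP => pR.
by have := noR R; rewrite R0 aR eqxx pR.
Qed.

(** The line [a] takes care of the points of [B] on it and is itself one of the [q - 2] lines; this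
    leaves [q - 3] lines for the rest. *)
Lemma off_not_covered (a P : V) (t : seq V) : P \in off a -> (size t < q - 2)%N ->
    (forall b, b \in t -> dot b P != 0) ->
  ~ (forall x, x \in off a :\ P -> exists2 b, b \in t & dot b x = 0).
Proof.
move=> Poff szt tP tcov; have [Pp pP aP] := offP Poff.
move/eqP: pP; apply; apply: (homog_eq0_cover (s := a :: t) hp) => //.
- exact: pts_neq0.
- by move=> b; rewrite inE => /predU1P[->|/tP].
move=> v pv cov; have [nB [c c0 vE]] := nrm_nonzeros pv.
case: (eqVneq (nrm v) P) => [nP|nP].
  by exists c^-1; rewrite -nP vE scalerA mulVf // scale1r.
have av := cov a (mem_head _ _).
have [|b bt] := tcov (nrm v).
  by rewrite in_setD1 nP inE nB /= vE dotZr mulf_neq0.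
rewrite vE dotZr => /eqP; rewrite mulf_eq0 (negPf c0) /= => bv.
by have := cov b; rewrite inE bt orbT bv => /(_ isT).
Qed.

(* If [B] contains the line [a] and more, at most [q - 3] points are left
   besides [a] and [P]. *)
Lemma full_line_off (a : V) : a != 0 ->
  (forall R : V, R != 0 -> dot a R = 0 -> p.@[R ord0] != 0) -> off a = set0.
Proof.
move=> a0 full; apply/eqP; rewrite -subset0; apply/subsetP => P Poff.
have q1 := finNzRing_gt1 F.
have secq := sec_full a0 full; have offE := card_off a.
have [Pp _ _] := offP Poff.
have [x|t [szt tP tcov]] := @cover_points _ P (enum (off a :\ P)).
  by rewrite mem_enum in_setD1 => /andP[xP /offP[xp _ _]]; rewrite pts_crs // eq_sym.
have := cardsD1 P (off a); rewrite Poff -cardE in szt * => offD.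
exfalso; apply: (off_not_covered Poff _ tP) => [|x xo].
  rewrite szt; move: small secq offE offD q1.
  by move: #|B| #|off a| #|off a :\ P| (sec _ _) q => b o o' n k; lia.
by apply: tcov; rewrite mem_enum.
Qed.

Lemma exists_form2 (x y : V) (s t : F) : crs x y != 0 ->
  exists L : V, dot L x = s /\ dot L y = t.
Proof.
move=> /dot_nondeg[u xyu].
exists ((dot (crs x y) u)^-1 *: (s *: crs y u + t *: crs u x)).
rewrite !dotZl !dotDl !dotZl dot_crsl dot_crsr -!(dot_crsC x) (dot_crsC u x y).
by rewrite !mulr0 addr0 add0r ![_^-1 * _]mulrC !mulfK.
Qed.

(* If [B] is the line [a], then on that line [p] differs by a linear form [L]
   from a form that is handled by [homog_eq0_cover], so [p] vanishes at the
   zero of [L] on the line. *)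
Lemma not_full_line (a : V) : a != 0 ->
  ~ (forall R : V, R != 0 -> dot a R = 0 -> p.@[R ord0] != 0).
Proof.
move=> a0 full; have q1 := finNzRing_gt1 F.
have off0 := full_line_off a0 full; have secq := sec_full a0 full.
have onl (v : V) : p.@[v ord0] != 0 -> dot a v = 0.
  move=> pv; apply/eqP; apply: contraT => av.
  have [nB [c c0 vE]] := nrm_nonzeros pv.
  suff : nrm v \in off a by rewrite off0 inE.
  by rewrite inE nB vE dotZr mulf_neq0.
have /card_gt1P[b1 [b2 []]] : (1 < sec B a)%N by rewrite secq ltnS ltnW.
rewrite !in_set => /andP[/andP[b1p pb1] /eqP ab1] /andP[/andP[b2p pb2] /eqP ab2] b12.
have {}b1p : b1 \in pts F by rewrite inE.
have {}b2p : b2 \in pts F by rewrite inE.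
have [L [Lb1 Lb2]] := exists_form2 p.@[b1 ord0] p.@[b2 ord0] (pts_crs b1p b2p b12).
pose P := crs a L.
have P0 : P != 0 by apply: (@crs_neq0 _ a L b1); rewrite ?Lb1.
have aP : dot a P = 0 by rewrite dotC dot_crsl.
have LP : dot L P = 0 by rewrite dotC dot_crsr.
(* As functions, [lin L ^+ q] is [L], and [lin a ^+ q.-1] is 0 on the line and 1 off it. So [r] is a
   form of degree [q] with the values of [p - L] on the line and 0 off it, where [p] vanishes. *)
pose r := p - lin L ^+ q + lin L * lin a ^+ q.-1.
have hr : r \is q.-homog.
  rewrite rpredD // ?rpredB //.
    by have := dhomogMn q (lin_homog L); rewrite mul1n.
  have := dhomogM (lin_homog L) (dhomogMn q.-1 (lin_homog a)).
  by rewrite mul1n add1n prednK // ltnW.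
have rE (v : V) : r.@[v ord0] = p.@[v ord0] - dot L v + dot L v * dot a v ^+ q.-1.
  rewrite mevalD mevalB mevalM !rmorphXn /= !meval_lin -!/(dot _ _).
  by rewrite expf_card.
have r_on (v : V) : dot a v = 0 -> r.@[v ord0] = p.@[v ord0] - dot L v.
  by rewrite rE => ->; rewrite expr0n -[_ == 0%N]negbK -lt0n ltn_predRL q1 mulr0 addr0.
have r_off (v : V) : dot a v != 0 -> r.@[v ord0] = 0.
  move=> av; rewrite rE expf_card_pred // mulr1 subrK.
  by apply/eqP; apply: contraNT av => /onl ->.
have rP : r.@[P ord0] = p.@[P ord0] by rewrite r_on // LP subr0.
have := full P P0 aP; rewrite -rP => /eqP; apply.
(* The line has [q] points besides that of [P], two too many for the covering. [L] agrees with [p]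
   at [b1] and [b2], so [r] vanishes there and [q - 2] points remain. *)
pose T := [set x in B | dot a x == 0] :\ nrm P :\ b1 :\ b2.
have [cP cP0 nPE] := nrm_scale P.
have nPB : nrm P \in [set x in B | dot a x == 0].
  rewrite inE nPE dotZr aP mulr0 eqxx andbT -nPE.
  by have [] := nrm_nonzeros (full P P0 aP).
have LnP : dot L (nrm P) = 0 by rewrite nPE dotZr LP mulr0.
have b1P : b1 != nrm P by apply: contraNneq pb1 => b1E; rewrite -Lb1 b1E LnP.
have b2P : b2 != nrm P by apply: contraNneq pb2 => b2E; rewrite -Lb2 b2E LnP.
have cT : (#|T| = q - 2)%N.
  have := cardsD1 (nrm P) [set x in B | dot a x == 0].
  rewrite nPB -/(sec B a) secq.
  have := cardsD1 b1 ([set x in B | dot a x == 0] :\ nrm P).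
  rewrite in_setD1 b1P inE inE b1p pb1 ab1 eqxx.
  have := cardsD1 b2 ([set x in B | dot a x == 0] :\ nrm P :\ b1).
  rewrite !in_setD1 b2P [b2 == _]eq_sym b12 inE inE b2p pb2 ab2 eqxx -/T.
  by move=> -> ->; rewrite !add1n => -[->]; rewrite subSS subSS subn0.
have [x|t [szt tP tcov]] := @cover_points _ P (enum T).
  rewrite mem_enum !in_setD1 => /and4P[_ _ xP xB].
  rewrite -(scalerK cP0 P) -nPE crsZl scaler_eq0 invr_eq0 (negPf cP0) /=.
  apply: pts_crs; first exact: nrm_pts.
    by move: xB; rewrite inE => /andP[/nonzerosP[]].
  by rewrite eq_sym.
apply: (homog_eq0_cover (s := t) hr) => //; first by rewrite szt -cardE cT.
move=> v rv cov.
have av : dot a v = 0 by apply/eqP; apply: contraNT rv => av; rewrite r_off.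
have v0 : v != 0.
  apply: contraNneq rv => ->.
  by rewrite -(scale0r 0) (homog_mevalZ _ _ hr) expr0n -[q == _]negbK -lt0n ltnW // mul0r.
have pv := full v v0 av; have [nB [c c0 vE]] := nrm_nonzeros pv.
case: (eqVneq (nrm v) (nrm P)) => [nP|nP].
  by exists (c^-1 * cP); rewrite -scalerA -nPE -nP vE scalerA mulVf // scale1r.
have rn : r.@[nrm v ord0] != 0 by rewrite vE (homog_mevalZ _ _ hr) mulf_neq0 // expf_neq0.
have nvT : nrm v \in T.
  rewrite !in_setD1 nP inE nB vE dotZr av mulr0 eqxx -vE !andbT.
  apply/andP; split; apply: contraNneq rn => ->; rewrite r_on //.
    by rewrite Lb2 subrr.
  by rewrite Lb1 subrr.
have [|b bt] := tcov (nrm v); first by rewrite mem_enum.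
rewrite vE dotZr => /eqP; rewrite mulf_eq0 (negPf c0) /= => bv.
by have := cov b bt; rewrite bv.
Qed.

Lemma off_geq (a : V) : a != 0 -> (q <= #|off a|)%N.
Proof. by move=> a0; case: (off_ge a0) => // /(not_full_line a0). Qed.

Lemma sec_leq (a : V) : a != 0 -> (sec B a <= q - 1)%N.
Proof. by move=> /off_geq; have := card_off a; lia. Qed.

End BlockingCurve.

(** * A small set of nonzero points forces [q = 4] *)

Section SmallBlockingCurve.

Local Open Scope ring_scope.

Variable F : finFieldType.
Local Notation q := #|F|.
Local Notation V := 'rV[F]_3.

Variable p : {mpoly F[3]}.

Local Notation B := (nonzeros p).

Hypothesis hp : p \is q.-homog.
Hypothesis blocking : forall a : V, a != 0 -> exists2 v, dot a v = 0 & p.@[v ord0] != 0.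
Hypothesis small : (#|B| <= 2 * q - 1)%N.

Let secB_gt0 := @sec_gt0 F p hp blocking.
Let secB_leq := @sec_leq F p hp blocking small.

(** Some line has at least three points of [B], and no line has more than [q - 1]. *)
Lemma card_ge4 : (4 <= q)%N.
Proof.
have [|a a0] := exists_secant (nonzeros_sub p) secB_gt0 (s := 2); first by left.
by have := secB_leq a0; lia.
Qed.

(** A secant with four points leaves at most [2 q - 6] points off it besides [P], just few enough
    for [q - 3] lines through two points each. The pairing requires that no line through [P] contain
    more than [q - 3] of them. *)
Lemma card_lt5 : (q < 5)%N.
Proof.
rewrite ltnNge; apply/negP => q5.
have [|a1 a10 sec1] := exists_secant (nonzeros_sub p) secB_gt0 (s := 3); first by right.
case: (@arg_maxnP _ a1 (fun a => a != 0) (sec B) a10) => a a0 amax.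
have seca : (3 < sec B a)%N by apply: leq_trans sec1 (amax _ a10).
have offE := card_off p a; have offq := off_geq hp blocking small a0.
have [P Poff] : exists P, P \in off p a by apply/card_gt0P; lia.
have [Pp pP aP] := offP Poff; have P0 := pts_neq0 Pp.
have offD := cardsD1 P (off p a); rewrite Poff in offD.
have collin x : x \in off p a :\ P ->
    (count (fun y => dot (crs P x) y == 0%R) (enum (off p a :\ P)) <= q - 3)%N.
  rewrite in_setD1 => /andP[xP xoff]; have [xp px ax] := offP xoff.
  have Px : crs P x != 0 by rewrite pts_crs // eq_sym.
  pose C := [set y in off p a :\ P | dot (crs P x) y == 0].
  have -> : count (fun y => dot (crs P x) y == 0) (enum (off p a :\ P)) = #|C|.
    rewrite -size_filter cardE; apply/perm_size/uniq_perm.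
    - by rewrite filter_uniq ?enum_uniq.
    - exact: enum_uniq.
    by move=> y; rewrite mem_filter !mem_enum [RHS]inE andbC.
  pose A := [set y in B | dot (crs P x) y == 0].
  have PA : P \in A by rewrite inE dot_crsl eqxx andbT; move: Poff; rewrite inE => /andP[].
  have CAs : C \subset A :\ P.
    apply/subsetP => y; rewrite inE in_setD1 => /andP[/andP[yP yoff] yPx].
    by rewrite in_setD1 yP inE yPx andbT; move: yoff; rewrite inE => /andP[].
  have AD := cardsD1 P A; rewrite PA in AD.
  have Aa : (#|A| <= sec B a)%N by apply: amax.
  have CA := subset_leq_card CAs.
  have seca' := secB_leq a0.
  (* The line [P x] has at most [sec B a] points, one of them [P]. Only [sec B a = q - 1] is
     critical, and then at most [q] points lie off [a]. *)
  case: (ltnP (sec B a) (q - 1)) => seca''.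
    move: AD Aa CA seca''; move: #|C| #|A :\ P| #|A| (sec B a) q; clear; lia.
  (* [R] is where [P x] meets [a]. If [p] vanishes at [R], projection from [R] separates [P] and
     [x]; otherwise [R] is a point of [B] on [P x] that is not off [a], which lowers the count by
     one. *)
  pose R := crs a (crs P x).
  have PxR : dot (crs P x) R = 0 by rewrite dotC dot_crsr.
  have aR : dot a R = 0 by rewrite dotC dot_crsl.
  have R0 : R != 0.
    by rewrite /R crsC oppr_eq0 (@crs_neq0 _ _ a P) ?dot_crsl.
  case: (eqVneq p.@[R ord0] 0) => pR.
    have [_ inj] := off_projection hp blocking a0 R0 aR pR.
    suff Px_eq : P = x by rewrite Px_eq eqxx in xP.
    apply: inj => //; last by rewrite dot_crsC.
    move: small offE seca''; move: #|off p a| (sec B a) #|B| q; clear; lia.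
  have [nB [c c0 nE]] := nrm_nonzeros hp pR.
  have CA' : C \subset A :\ P :\ nrm R.
    apply/subsetP => y yC; rewrite in_setD1 (subsetP CAs) // andbT.
    apply: contraTneq yC => ->.
    by rewrite !inE nE dotZr aR mulr0 eqxx !andbF.
  have := cardsD1 (nrm R) (A :\ P).
  have -> : nrm R \in A :\ P.
    rewrite in_setD1 [_ \in A]inE nB nE dotZr PxR mulr0 eqxx !andbT.
    by apply: contraNneq aP => <-; rewrite dotZr aR mulr0.
  have := subset_leq_card CA'; move: AD Aa seca' q5.
  move: #|C| #|_ :\ nrm R| #|A :\ P| #|A| (sec B a) q; clear; lia.
have [x|||t [szt tP tcov]] := @cover_pairs _ P (enum (off p a :\ P)) (q - 3) P0.
- by rewrite mem_enum in_setD1 => /andP[xP /offP[xp _ _]]; rewrite pts_crs // eq_sym.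
- rewrite -cardE; move: small offE offD seca.
  move: #|off p a :\ P| #|off p a| (sec B a) #|B| q; clear; lia.
- by move=> x; rewrite mem_enum; apply: collin.
apply: (off_not_covered hp Poff _ tP) => [|x xo]; first by rewrite szt; lia.
by apply: tcov; rewrite mem_enum.
Qed.

End SmallBlockingCurve.

(** * The exceptional quartic *)

Section ExceptionalQuartic.

Local Open Scope ring_scope.

Variable F : finFieldType.
Local Notation q := #|F|.
Local Notation V := 'rV[F]_3.

Hypothesis q4 : q = 4%N.

Lemma card4_char2 : 2%:R = 0 :> F.
Proof.
have := natr_card_eq0 F; rewrite q4 -[4%N]/(2 * 2)%N natrM => /eqP.
by rewrite mulf_eq0 orbb => /eqP.
Qed.

Lemma card4_expr3 (x : F) : x != 0 -> x ^+ 3 = 1.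
Proof. by move=> x0; have := expf_card_pred x0; rewrite q4. Qed.

Lemma card4_expr4 (x : F) : x ^+ 4 = x.
Proof. by have := expf_card x; rewrite q4. Qed.

Lemma meval_exceptional (v : 'I_3 -> F) :
  (exceptional_quartic F).@[v] =
    v 0 ^+ 4 + v 1 ^+ 4 + v 2 ^+ 4
    + v 0 ^+ 2 * v 1 ^+ 2 + v 1 ^+ 2 * v 2 ^+ 2 + v 2 ^+ 2 * v 0 ^+ 2
    + v 0 ^+ 2 * v 1 * v 2 + v 0 * v 1 ^+ 2 * v 2 + v 0 * v 1 * v 2 ^+ 2.
Proof.
by rewrite /exceptional_quartic !mevalD !mevalM !mevalXU.
Qed.

Lemma exceptional_homog : exceptional_quartic F \is 4.-homog.
Proof.
have hX i : ('X_i : {mpoly F[3]}) \is 1.-homog by rewrite dhomogX /= mdeg1.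
have hXn i k : ('X_i ^+ k : {mpoly F[3]}) \is k.-homog.
  by have := dhomogMn k (hX i); rewrite mul1n.
apply: rpredD; last exact: (dhomogM (dhomogM (hX 0) (hX 1)) (hXn 2 2%N)).
apply: rpredD; last exact: (dhomogM (dhomogM (hX 0) (hXn 1 2%N)) (hX 2)).
apply: rpredD; last exact: (dhomogM (dhomogM (hXn 0 2%N) (hX 1)) (hX 2)).
apply: rpredD; last exact: (dhomogM (hXn 2 2%N) (hXn 0 2%N)).
apply: rpredD; last exact: (dhomogM (hXn 1 2%N) (hXn 2 2%N)).
apply: rpredD; last exact: (dhomogM (hXn 0 2%N) (hXn 1 2%N)).
apply: rpredD; last exact: (hXn 2 4%N).
by apply: rpredD; [exact: (hXn 0 4%N) | exact: (hXn 1 4%N)].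
Qed.

(* With [s = x^2 + x y + y^2 = 0], the quartic reduces modulo [s] and 2 to
   [z^4 - x^3 z]. *)
Lemma exceptional_eq0 (x y z : F) : x != 0 -> y != 0 -> x != y ->
  x ^+ 4 + y ^+ 4 + z ^+ 4 + x ^+ 2 * y ^+ 2 + y ^+ 2 * z ^+ 2 + z ^+ 2 * x ^+ 2
    + x ^+ 2 * y * z + x * y ^+ 2 * z + x * y * z ^+ 2 = 0.
Proof.
move=> x0 y0 xy; pose s := x ^+ 2 + x * y + y ^+ 2.
have s0 : s = 0.
  have : (x - y) * s = 0.
    by transitivity (x ^+ 3 - y ^+ 3); [rewrite /s; ring | rewrite !card4_expr3 ?subrr].
  by move/eqP; rewrite mulf_eq0 subr_eq0 (negPf xy) => /eqP.
transitivity ((z ^+ 4 - z) + z ^+ 2 * s + z * x * s - z * (x ^+ 3 - 1) + s ^+ 2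
   - 2%:R * (x ^+ 2 * y ^+ 2 + x ^+ 3 * y + x * y ^+ 3)); first by rewrite /s; ring.
by rewrite card4_expr4 card4_expr3 // s0 card4_char2 !subrr expr0n /= !(mulr0, mul0r, addr0, subr0).
Qed.

(** Since the quartic is symmetric, [exceptional_eq0] applies to any two coordinates. Hence the
    nonzero coordinates at a point where it does not vanish are all equal: only the seven points
    with coordinates 0 and 1 are left. *)
Lemma exceptional_supp (v : 'I_3 -> F) i j : (exceptional_quartic F).@[v] != 0 ->
  [|| v i == 0, v j == 0 | v i == v j].
Proof.
apply: contraNT; rewrite !negb_or meval_exceptional => /and3P[vi vj vij].
suff H : forall i j : 'I_3, (i < j)%N -> v i != 0 -> v j != 0 -> v i != v j ->
  (exceptional_quartic F).@[v] == 0.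
  case: (ltngtP i j) => ij; rewrite -?meval_exceptional; first exact: (H i j).
    by apply: (H j i) => //; rewrite eq_sym.
  by move: vij; rewrite (ord_inj ij) eqxx.
move=> {vi vj vij} {}i {}j; rewrite meval_exceptional.
move: i j; apply: ord3P; apply: ord3P => //= _ vi vj vij; apply/eqP.
- by rewrite -[RHS](exceptional_eq0 (v 2) vi vj vij).
- by rewrite -[RHS](exceptional_eq0 (v 1) vi vj vij); ring.
by rewrite -[RHS](exceptional_eq0 (v 0) vi vj vij); ring.
Qed.

End ExceptionalQuartic.

(** * The Fano plane over the field with four elements *)

Section FanoPlane.

Local Open Scope ring_scope.

Variable F : finFieldType.
Local Notation q := #|F|.
Local Notation V := 'rV[F]_3.

Variable p : {mpoly F[3]}.

Local Notation B := (nonzeros p).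

Hypothesis q4 : q = 4%N.
Hypothesis hp : p \is q.-homog.
Hypothesis blocking : forall a : V, a != 0 -> exists2 v, dot a v = 0 & p.@[v ord0] != 0.
Hypothesis small : (#|B| <= 2 * q - 1)%N.

(** The bounds [3 <= sec B a <= q - 1], [q <= #|off p a|] and [#|B| <= 7] leave no other values. *)
Lemma fano_line : exists2 a : V, a != 0 & sec B a = 3%N /\ #|off p a| = 4%N.
Proof.
have [|a a0 sa] := exists_secant (nonzeros_sub p) (sec_gt0 hp blocking) (s := 2).
  by left.
have := sec_leq hp blocking small a0; have := off_geq hp blocking small a0.
have := card_off p a; move: small sa; rewrite q4 => h1 h2 h3 h4 h5.
by exists a => //; move: h1 h2 h3 h4 h5; move: (sec B a) #|off p a| #|B|; clear; lia.
Qed.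

Section Line.

Variable a : V.
Hypothesis a0 : a != 0.
Hypothesis seca : sec B a = 3%N.
Hypothesis offa : #|off p a| = 4%N.

Local Notation O := (off p a).

Lemma off_mem (s : seq V) : uniq s -> size s = 4%N -> {subset s <= O} -> s =i O.
Proof.
move=> us szs sO; have := uniq_min_size us (s2 := enum O).
rewrite szs -cardE offa => /(_ _ (leqnn _))[].
  by move=> x /sO; rewrite mem_enum.
by move=> _ h x; rewrite h mem_enum.
Qed.

(** If three of the four points were on a line, the fourth would either make it a line with four
    points of [B], more than [q - 1], or be missed by this single line that covers the others,
    against [off_not_covered]. *)
Lemma off_noncollinear (x y z : V) :
    x \in O -> y \in O -> z \in O ->
    x != y -> x != z -> y != z -> dot (crs x y) z != 0.
Proof.
move=> xO yO zO xy xz yz; apply/eqP => xyz.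
have [w wO wxyz] : exists2 w, w \in O & w \notin [:: x; y; z].
  apply/subsetPn; apply/negP => /subset_leq_card.
  by rewrite offa leqNgt ltnS card_size.
have wE : [:: w; x; y; z] =i O.
  apply: off_mem => [|//|v]; first by rewrite cons_uniq wxyz /= !inE negb_or xy xz yz.
  by rewrite !in_cons in_nil orbF => /or4P[]/eqP->.
have [xp px ax] := offP xO; have [yp py ay] := offP yO.
have xy0 : crs x y != 0 by apply: pts_crs.
case: (eqVneq (dot (crs x y) w) 0) => [xyw|xyw].
  have : (4 <= sec B (crs x y))%N.
    rewrite -offa; apply: subset_leq_card; apply/subsetP => v vO.
    rewrite inE; apply/andP; split; first by move: vO; rewrite inE => /andP[].
    move: vO; rewrite -wE !inE => /or4P[]/eqP->; rewrite ?xyw ?xyz ?eqxx //.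
      by rewrite dot_crsl.
    by rewrite dot_crsr.
  by have := sec_leq hp blocking small xy0; rewrite q4; clear; lia.
apply: (off_not_covered hp wO (t := [:: crs x y])); rewrite ?q4 //.
  by move=> b; rewrite inE => /eqP->.
move=> v; rewrite in_setD1 -wE !inE => /andP[/negPf-> /=] /or3P[]/eqP->;
  exists (crs x y); by rewrite ?mem_head ?dot_crsl ?dot_crsr.
Qed.

(** The point where the side [x y] of the quadrangle [O] meets the line [a]. *)
Definition diag (x y : V) : V := crs a (crs x y).

Lemma diagE (x y : V) : diag x y = dot a y *: x - dot a x *: y.
Proof. exact: crs_crs. Qed.

Lemma diag_line (x y : V) : dot a (diag x y) = 0.
Proof. by rewrite dotC dot_crsl. Qed.

Lemma diagC (x y : V) : diag y x = - diag x y.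
Proof. by rewrite !diagE opprB. Qed.

(** Otherwise projection from this point would be injective on the [q] points off [a], yet [x] and
    [y] are collinear with it. *)
Lemma diag_nonzero (x y : V) : x \in O -> y \in O -> x != y -> p.@[diag x y ord0] != 0.
Proof.
move=> xO yO xy; have [xp px ax] := offP xO; have [yp py ay] := offP yO.
have xy0 : crs x y != 0 by rewrite pts_crs.
have d0 : diag x y != 0.
  by rewrite /diag crsC oppr_eq0 (@crs_neq0 _ _ a x) ?dot_crsl.
apply/eqP => pd; case: (off_projection hp blocking a0 d0 (diag_line x y) pd) => _.
rewrite offa q4 => /(_ isT) inj; move/eqP: xy; apply; apply: inj => //.
by rewrite dot_crsC dotC /diag dot_crsr.
Qed.

(** The line [x y] contains the first point but not the second, because [x], [y], [z] are not
    collinear. *)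
Lemma diag_distinct (x y z : V) :
    x \in O -> y \in O -> z \in O ->
    x != y -> x != z -> y != z -> nrm (diag x y) != nrm (diag x z).
Proof.
move=> xO yO zO xy xz yz; have xyz := off_noncollinear xO yO zO xy xz yz.
have [_ _ ax] := offP xO.
have [c c0 cE] := nrm_scale (diag x y); have [d d0 dE] := nrm_scale (diag x z).
have : dot (crs x y) (nrm (diag x z)) != 0.
  rewrite dE dotZr mulf_neq0 // diagE dotDr dotNr !dotZr dot_crsl mulr0 add0r.
  by rewrite oppr_eq0 mulf_neq0.
apply: contraNneq => <-.
by rewrite cE dotZr diagE dotDr dotNr !dotZr dot_crsl dot_crsr !mulr0 subr0 mulr0.
Qed.

Lemma nrm_diagC (x y : V) : nrm (diag y x) = nrm (diag x y).
Proof. by rewrite diagC -scaleN1r nrmZ // oppr_eq0 oner_eq0. Qed.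

Lemma sec_mem (s : seq V) : uniq s -> size s = 3%N ->
  {subset s <= [set v in B | dot a v == 0]} -> s =i [set v in B | dot a v == 0].
Proof.
move=> us szs sO; have := uniq_min_size us (s2 := enum [set v in B | dot a v == 0]).
rewrite szs -cardE -/(sec B a) seca => /(_ _ (leqnn _))[].
  by move=> x /sO; rewrite mem_enum.
by move=> _ h x; rewrite h mem_enum.
Qed.

Lemma nrm_diag_mem (x y : V) : x \in O -> y \in O -> x != y ->
  nrm (diag x y) \in [set v in B | dot a v == 0].
Proof.
move=> xO yO xy; have [nB [c c0 cE]] := nrm_nonzeros hp (diag_nonzero xO yO xy).
by rewrite inE nB cE dotZr diag_line mulr0 eqxx.
Qed.

Lemma diag_mem (x y z w : V) : uniq [:: x; y; z; w] -> {subset [:: x; y; z; w] <= O} ->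
  [:: nrm (diag x y); nrm (diag x z); nrm (diag x w)]
    =i [set v in B | dot a v == 0].
Proof.
rewrite /= !inE !negb_or => /and4P[/and3P[xy xz xw] /andP[yz yw] zw _] sO.
have [xO yO zO wO] : [/\ x \in O, y \in O, z \in O & w \in O].
  by split; apply: sO; rewrite !inE eqxx ?orbT.
apply: sec_mem => //.
  by rewrite /= !inE !negb_or !diag_distinct.
by move=> v; rewrite !in_cons => /or4P[/eqP->|/eqP->|/eqP->|//]; rewrite nrm_diag_mem.
Qed.

(* The six lines joining the four points of [B] off [a] meet [a] in only three
   points of [B], so opposite lines meet on [a]. *)
Lemma diag_opposite (x y z w : V) : uniq [:: x; y; z; w] ->
    {subset [:: x; y; z; w] <= O} ->
  nrm (diag y z) = nrm (diag x w).
Proof.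
move=> us sO; have dm := diag_mem us sO.
move: us; rewrite /= !inE !negb_or => /and4P[/and3P[xy xz xw] /andP[yz yw] zw _].
have [xO yO zO wO] : [/\ x \in O, y \in O, z \in O & w \in O].
  by split; apply: sO; rewrite !inE eqxx ?orbT.
(* The point of the side [y z] is one of the three on the sides through [x], and differs from those
   of [x y] and [x z], which share a vertex with it. *)
have := nrm_diag_mem yO zO yz; rewrite -dm !inE.
rewrite -(nrm_diagC x y) -(nrm_diagC x z).
case/or3P => /eqP //; move/eqP.
  by rewrite eq_sym (negPf (diag_distinct _ _ _ _ _ _)) // eq_sym.
by rewrite (nrm_diagC z y) eq_sym (negPf (diag_distinct _ _ _ _ _ _)) // eq_sym.
Qed.

(** Obtained by writing that [diag x w] lies on the line [y z]. It says that [a] takes the same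
    value at [w] and at the component of [w] along [x] in the basis [x, y, z]. *)
Lemma frame_eq (x y z w : V) : uniq [:: x; y; z; w] -> {subset [:: x; y; z; w] <= O} ->
  dot a w * dot (crs y z) x = dot a x * dot (crs y z) w.
Proof.
move=> us sO; have dE := diag_opposite us sO.
have [c c0 cE] := nrm_scale (diag y z); have [d d0 dE'] := nrm_scale (diag x w).
have : d * dot (crs y z) (diag x w) = 0.
  rewrite -dotZr -dE' -dE cE dotZr diagE dotDr dotNr !dotZr dot_crsl dot_crsr.
  by rewrite !mulr0 subr0 mulr0.
move/eqP; rewrite mulf_eq0 (negPf d0) diagE dotDr dotNr !dotZr subr_eq0.
by move/eqP.
Qed.

(** Scaling three points off [a] so that the fourth becomes their sum gives them equal values under
    [a]. Signs disappear in characteristic 2, so the points on [a] become the sums of two basis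
    vectors. *)
Lemma fano_frame : exists u1 u2 u3 : V, exists2 al, al != 0 &
  [/\ dot (crs u1 u2) u3 != 0,
      [/\ dot a u1 = al, dot a u2 = al & dot a u3 = al],
      p.@[(u1 + u2 + u3) ord0] != 0 &
      forall v : V, p.@[v ord0] != 0 -> exists c, exists2 e,
        e \in [:: u1; u2; u3; u1 + u2 + u3; u1 + u2; u1 + u3; u2 + u3] & v = c *: e].
Proof.
have [x [y [z [w eO]]]] : exists x y z w, enum O = [:: x; y; z; w].
  move: offa; rewrite cardE; case: (enum O) => [|x [|y [|z [|w [|]]]]] // _.
  by exists x, y, z, w.
have us : uniq [:: x; y; z; w] by rewrite -eO enum_uniq.
have OE v : (v \in [:: x; y; z; w]) = (v \in O) by rewrite -eO mem_enum.
have sO : {subset [:: x; y; z; w] <= O} by move=> v; rewrite OE.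
have [xO yO zO wO] : [/\ x \in O, y \in O, z \in O & w \in O].
  by split; apply: sO; rewrite !inE eqxx ?orbT.
have [xyz yzx zxy] : [/\ dot a w * dot (crs y z) x = dot a x * dot (crs y z) w,
    dot a w * dot (crs z x) y = dot a y * dot (crs z x) w &
    dot a w * dot (crs x y) z = dot a z * dot (crs x y) w].
  have frame x' y' z' : perm_eq [:: x'; y'; z'; w] [:: x; y; z; w] ->
      dot a w * dot (crs y' z') x' = dot a x' * dot (crs y' z') w.
    move=> pe; apply: frame_eq; first by rewrite (perm_uniq pe).
    by move=> v; rewrite (perm_mem pe); apply: sO.
  split; apply: frame => //.
    exact/permPl/(perm_catCA [:: y; z] [:: x]).
  exact/permPl/(perm_catCA [:: z] [:: x; y]).
have [_ pw aw] := offP wO.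
have dm := diag_mem us sO; have dop := diag_opposite us sO.
move: us; rewrite /= !inE !negb_or => /and4P[/and3P[xy xz xw] /andP[yz yw] zw _].
pose D := dot (crs x y) z.
have D0 : D != 0 by apply: off_noncollinear.
rewrite -[dot (crs y z) x]dot_crsC -/D in xyz.
rewrite [dot (crs z x) y]dot_crsC -/D in yzx; rewrite -/D in zxy.
(* The coordinates of [w] in the basis [x, y, z], by Cramer's rule. *)
pose c1 := dot (crs y z) w / D; pose c2 := dot (crs z x) w / D; pose c3 := dot (crs x y) w / D.
have a1 : dot a (c1 *: x) = dot a w.
  by rewrite dotZr mulrAC [_ * dot a x]mulrC -xyz mulfK.
have a2 : dot a (c2 *: y) = dot a w.
  by rewrite dotZr mulrAC [_ * dot a y]mulrC -yzx mulfK.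
have a3 : dot a (c3 *: z) = dot a w.
  by rewrite dotZr mulrAC [_ * dot a z]mulrC -zxy mulfK.
have wE : w = c1 *: x + c2 *: y + c3 *: z.
  by apply: (scalerI D0); rewrite cramer !scalerDr !scalerA !(mulrC D) !divfK.
have c10 : c1 != 0 by apply: contraNneq aw => c0; rewrite -a1 c0 dotZr mul0r.
have c20 : c2 != 0 by apply: contraNneq aw => c0; rewrite -a2 c0 dotZr mul0r.
have c30 : c3 != 0 by apply: contraNneq aw => c0; rewrite -a3 c0 dotZr mul0r.
have diag_scale (s t : F) (u v : V) : s != 0 -> t != 0 ->
    dot a (s *: u) = dot a w -> dot a (t *: v) = dot a w ->
    exists c, diag u v = c *: (s *: u + t *: v).
  move=> s0 t0; rewrite !dotZr => su tv; exists (dot a w / (s * t)).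
  rewrite diagE scalerDr !scalerA.
  have -> : dot a w / (s * t) * s = dot a v by rewrite -tv; field; rewrite ?s0 ?t0.
  have -> : dot a w / (s * t) * t = dot a u by rewrite -su; field; rewrite ?s0 ?t0.
  congr (_ + _); rewrite -scaleNr; congr (_ *: _); apply/eqP.
  by rewrite eq_sym -addr_eq0 -mulr2n -mulr_natl card4_char2 // mul0r.
exists (c1 *: x), (c2 *: y), (c3 *: z), (dot a w) => //.
rewrite -wE; split=> //.
  by rewrite crsZl crsZr !dotZl dotZr; do 3!apply: mulf_neq0 => //.
move=> v pv; have [nB [c c0 vE]] := nrm_nonzeros hp pv.
have {vE}vE : v = c^-1 *: nrm v by rewrite vE scalerA mulVf // scale1r.
have prop (u e : V) (s : F) : nrm v = u -> u = s *: e -> exists c', v = c' *: e.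
  by move=> nu ue; exists (c^-1 * s); rewrite vE nu ue scalerA.
have nprop (u e : V) (s : F) : nrm v = nrm u -> u = s *: e -> exists c', v = c' *: e.
  move=> nu ue; have [t t0 tE] := nrm_scale u.
  by apply: (prop _ _ (t * s) nu); rewrite tE ue scalerA.
case: (eqVneq (dot a v) 0) => av.
  have := dm (nrm v); rewrite [RHS]inE nB.
  have -> : dot a (nrm v) = 0 by move/eqP: av; rewrite {1}vE dotZr mulf_eq0 invr_eq0 (negPf c0) => /eqP.
  rewrite eqxx !in_cons in_nil orbF -dop => /or3P[]/eqP nE.
  - have [s sE] := diag_scale _ _ _ _ c10 c20 a1 a2.
    by have [t tE] := nprop _ _ _ nE sE; exists t, (c1 *: x + c2 *: y); rewrite // !inE eqxx ?orbT.
  - have [s sE] := diag_scale _ _ _ _ c10 c30 a1 a3.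
    by have [t tE] := nprop _ _ _ nE sE; exists t, (c1 *: x + c3 *: z); rewrite // !inE eqxx ?orbT.
  have [s sE] := diag_scale _ _ _ _ c20 c30 a2 a3.
  by have [t tE] := nprop _ _ _ nE sE; exists t, (c2 *: y + c3 *: z); rewrite // !inE eqxx ?orbT.
have : nrm v \in O.
  by rewrite inE nB; apply: contraNneq av => av; rewrite vE dotZr av mulr0.
have unit (u : V) s : s != 0 -> u = s^-1 *: (s *: u).
  by move=> s0; rewrite scalerA mulVf // scale1r.
rewrite -OE !in_cons in_nil orbF => /or4P[]/eqP nE.
- by have [t tE] := prop _ _ _ nE (unit x _ c10); exists t, (c1 *: x); rewrite // !inE eqxx ?orbT.
- by have [t tE] := prop _ _ _ nE (unit y _ c20); exists t, (c2 *: y); rewrite // !inE eqxx ?orbT.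
- by have [t tE] := prop _ _ _ nE (unit z _ c30); exists t, (c3 *: z); rewrite // !inE eqxx ?orbT.
exists c^-1, w; first by rewrite !inE eqxx ?orbT.
by rewrite -nE.
Qed.

End Line.

End FanoPlane.

(** * The form is determined by its Fano plane up to a scalar *)

Section Uniqueness.

Local Open Scope ring_scope.

Lemma meval_linear_subst (F : fieldType) (A : 'M[F]_3) (p : {mpoly F[3]}) (v : 'I_3 -> F) :
  (linear_subst A p).@[v] = p.@[fun i => \sum_(j < 3) A i j * v j].
Proof.
rewrite comp_mpoly_meval; apply: meval_eq => i; rewrite tnth_mktuple raddf_sum.
by apply: eq_bigr => j _; rewrite /= mevalZ mevalXU.
Qed.

Lemma linear_subst_homog (F : fieldType) (A : 'M[F]_3) (p : {mpoly F[3]}) d :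
  p \is d.-homog -> linear_subst A p \is d.-homog.
Proof.
move=> hp; apply: homog_comp => // i; rewrite tnth_mktuple.
by apply: rpred_sum => j _; apply: dhomogZ; rewrite dhomogX /= mdeg1.
Qed.

Variable F : finFieldType.
Local Notation q := #|F|.
Local Notation V := 'rV[F]_3.

Variable p : {mpoly F[3]}.

Hypothesis q4 : q = 4%N.
Hypothesis hp : p \is q.-homog.
Hypothesis blocking : forall a : V, a != 0 -> exists2 v, dot a v = 0 & p.@[v ord0] != 0.
Hypothesis small : (#|nonzeros p| <= 2 * q - 1)%N.

(** Subtracting the multiple of the transformed quartic that agrees with [p] at [w] leaves a form
    supported on the same seven points and zero at [w]. The other six values are then forced to 0 by
    covering with [q - 2 = 2] lines. *)
Lemma proj_equivalent_exceptional : proj_equivalent p (exceptional_quartic F).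
Proof.
have [a a0 [seca offa]] := fano_line q4 hp blocking small.
have [u1 [u2 [u3 [al al0 [D0 [au1 au2 au3] pw supp_p]]]]] :=
  fano_frame q4 hp blocking small a0 seca offa.
have al2 : al + al = 0 by rewrite -mulr2n -mulr_natl card4_char2 // mul0r.
pose w := u1 + u2 + u3; pose D := dot (crs u1 u2) u3.
pose L := [:: u1; u2; u3; w; u1 + u2; u1 + u3; u2 + u3].
pose k1 := crs u2 u3; pose k2 := crs u3 u1; pose k3 := crs u1 u2.
have Dn0 : D != 0 by exact: D0.
have kE : ((dot k1 u1 = D) * (dot k1 u2 = 0) * (dot k1 u3 = 0)) *
          ((dot k2 u1 = 0) * (dot k2 u2 = D) * (dot k2 u3 = 0)) *
          ((dot k3 u1 = 0) * (dot k3 u2 = 0) * (dot k3 u3 = D)).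
  rewrite /k1 /k2 /k3 !dot_crsl !dot_crsr /D -(dot_crsC u1) (dot_crsC u3 u1).
  by [].
(* Divided by [D], the vectors [K i] form the dual basis, so [Y v] is the coordinate vector of [v]
   in [u1, u2, u3]. *)
pose K (i : 'I_3) : V := [:: k1; k2; k3]`_i.
pose A : 'M[F]_3 := \matrix_(i, j) (K i ord0 j / D).
pose Y (v : V) (i : 'I_3) := \sum_(j < 3) A i j * v ord0 j.
have YE v i : Y v i = dot (K i) v / D.
  rewrite /Y /dot mulr_suml; apply: eq_bigr => j _; rewrite mxE mulrAC //.
have vE v : v = Y v 0 *: u1 + Y v 1 *: u2 + Y v 2 *: u3.
  apply: (scalerI D0); rewrite !YE cramer !scalerDr !scalerA -/D !(mulrC D) !divfK //.
have A_unit : A \in unitmx.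
  pose C : 'M[F]_3 := \matrix_(i, j) ([:: u1; u2; u3]`_j ord0 i).
  suff /mulmx1_unit[] : A *m C = 1%:M by [].
  apply/matrixP => i j; rewrite !mxE.
  have -> : \sum_k A i k * C k j = Y [:: u1; u2; u3]`_j i.
    by apply: eq_bigr => k _; rewrite [C k j]mxE.
  rewrite YE; move: i j; apply: ord3P; apply: ord3P; rewrite /K /= kE.
  all: rewrite ?mul0r ?divff //.
pose E := linear_subst A (exceptional_quartic F).
have EE (v : V) : E.@[v ord0] = (exceptional_quartic F).@[Y v].
  by rewrite meval_linear_subst.
have supp_E (v : V) : E.@[v ord0] != 0 -> exists c, exists2 e, e \in L & v = c *: e.
  rewrite EE => Ev; rewrite (vE v).
  have := exceptional_supp q4 0 1 Ev; have := exceptional_supp q4 0 2 Ev.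
  have := exceptional_supp q4 1 2 Ev.
  case: (eqVneq (Y v 0) 0) => [->|y0]; case: (eqVneq (Y v 1) 0) => [->|y1];
    case: (eqVneq (Y v 2) 0) => [->|y2] /=.
  - by exists 0, u1; rewrite ?mem_head // !scale0r !addr0.
  - by exists (Y v 2), u3; rewrite ?inE ?eqxx ?orbT // !scale0r !add0r.
  - by exists (Y v 1), u2; rewrite ?inE ?eqxx ?orbT // !scale0r add0r addr0.
  - move=> /eqP -> _ _; exists (Y v 2), (u2 + u3); first by rewrite !inE eqxx ?orbT.
    by rewrite scale0r add0r scalerDr.
  - by exists (Y v 0), u1; rewrite ?inE ?eqxx ?orbT // !scale0r !addr0.
  - move=> _ /eqP -> _; exists (Y v 2), (u1 + u3); first by rewrite !inE eqxx ?orbT.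
    by rewrite scale0r addr0 scalerDr.
  - move=> _ _ /eqP ->; exists (Y v 1), (u1 + u2); first by rewrite !inE eqxx ?orbT.
    by rewrite scale0r addr0 scalerDr.
  move=> _ /eqP -> /eqP <-; exists (Y v 2), w; first by rewrite !inE eqxx ?orbT.
  by rewrite /w !scalerDr.
have hE : E \is q.-homog by rewrite q4; apply: linear_subst_homog; apply: exceptional_homog.
pose G := p - p.@[w ord0] *: E.
have hG : G \is q.-homog by rewrite rpredB // dhomogZ.
have GE (v : V) : G.@[v ord0] = p.@[v ord0] - p.@[w ord0] * E.@[v ord0].
  by rewrite mevalB mevalZ.
have supp_G (v : V) : G.@[v ord0] != 0 -> exists c, exists2 e, e \in L & v = c *: e.
  case: (eqVneq E.@[v ord0] 0) => [E0|/supp_E //].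
  by rewrite GE E0 mulr0 subr0 => /supp_p.
(* The quartic has nine terms, so its value at [w] is [9 = 1]. *)
have Gw : G.@[w ord0] = 0.
  have Yw i : Y w i = 1.
    by rewrite YE /w; move: i; apply: ord3P; rewrite /K /= !dotDr !kE ?addr0 ?add0r divff.
  rewrite GE EE meval_exceptional !Yw.
  transitivity (- (2%:R : F) * 4%:R * p.@[w ord0]); first by ring.
  by rewrite card4_char2 // oppr0 !mul0r.
have kill (e b1 b2 : V) : dot b1 e != 0 -> dot b2 e != 0 ->
    (forall e', e' \in L -> e' != e -> G.@[e' ord0] != 0 ->
       dot b1 e' != 0 -> dot b2 e' != 0 -> False) -> G.@[e ord0] = 0.
  move=> b1e b2e He; apply: (homog_eq0_cover (s := [:: b1; b2]) hG).
  - by rewrite q4.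
  - by apply: contraNneq b1e => ->; rewrite -(scale0r 0) dotZr mul0r.
  - by move=> b; rewrite !inE => /orP[]/eqP->.
  move=> v Gv bv; have [c [e' e'L veE]] := supp_G v Gv; exists c.
  case: (eqVneq e' e) => [<- //|ne]; exfalso; apply: (He e') => //.
  - by apply: contraNneq Gv => Ge; rewrite veE (homog_mevalZ _ _ hG) Ge mulr0.
  - have := bv b1; rewrite veE dotZr mulf_eq0 negb_or.
    by rewrite inE eqxx => /(_ isT)/andP[].
  have := bv b2; rewrite veE dotZr mulf_eq0 negb_or.
  by rewrite !inE eqxx orbT => /(_ isT)/andP[].
have LP (P : V -> Prop) : P u1 -> P u2 -> P u3 -> P w -> P (u1 + u2) -> P (u1 + u3) ->
    P (u2 + u3) -> forall e, e \in L -> P e.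
  move=> P1 P2 P3 Pw P12 P13 P23 e; rewrite /L.
  by do 7!(rewrite in_cons => /predU1P[-> //|]).
have aL : (dot a (u1 + u2) = 0) * (dot a (u1 + u3) = 0) * (dot a (u2 + u3) = 0).
  by rewrite !dotDr au1 au2 au3.
(* The line [a] contains the three sums of two basis vectors, and [k1] contains [u2] and [u3]; both
   avoid [u1]. *)
have G1 : G.@[u1 ord0] = 0.
  apply: (kill _ a k1); rewrite ?kE ?au1 //.
  by apply: LP; rewrite ?aL ?kE ?Gw ?eqxx.
have G2 : G.@[u2 ord0] = 0.
  apply: (kill _ a k2); rewrite ?kE ?au2 //.
  by apply: LP; rewrite ?aL ?kE ?Gw ?eqxx.
have G3 : G.@[u3 ord0] = 0.
  apply: (kill _ a k3); rewrite ?kE ?au3 //.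
  by apply: LP; rewrite ?aL ?kE ?Gw ?eqxx.
(* Only the sums of two basis vectors remain: [k1] contains [u2 + u3], [k2] contains [u1 + u3], and
   both avoid [u1 + u2]. *)
have G12 : G.@[(u1 + u2) ord0] = 0.
  apply: (kill _ k1 k2); rewrite ?dotDr ?kE ?addr0 ?add0r //.
  by apply: LP; rewrite ?G1 ?G2 ?G3 ?Gw ?dotDr ?kE ?addr0 ?eqxx.
have G13 : G.@[(u1 + u3) ord0] = 0.
  apply: (kill _ k1 k3); rewrite ?dotDr ?kE ?addr0 ?add0r //.
  by apply: LP; rewrite ?G1 ?G2 ?G3 ?Gw ?dotDr ?kE ?addr0 ?eqxx.
have G23 : G.@[(u2 + u3) ord0] = 0.
  apply: (kill _ k2 k3); rewrite ?dotDr ?kE ?addr0 ?add0r //.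
  by apply: LP; rewrite ?G1 ?G2 ?G3 ?Gw ?dotDr ?kE ?addr0 ?eqxx.
have G0 : G = 0.
  apply: homog_card_eq0 => // v; apply/eqP; apply: contraT => Gv.
  have [c [e eL veE]] := supp_G v Gv; move: Gv; rewrite veE (homog_mevalZ _ _ hG).
  suff -> : G.@[e ord0] = 0 by rewrite mulr0 eqxx.
  by move: e eL {veE}; apply: LP.
exists A, p.@[w ord0]; split=> //.
by apply/eqP; rewrite -subr_eq0 -/E -/G G0.
Qed.

End Uniqueness.

(** * The bound and a curve attaining it *)

Section Bound.

Local Open Scope ring_scope.

Variable F : finFieldType.
Local Notation q := #|F|.
Local Notation V := 'rV[F]_3.

Lemma card_pts : #|pts F| = (q ^ 2 + q + 1)%N.
Proof.
have : (#|[set~ (0%R : V)]| = #|pts F| * q.-1)%N.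
  rewrite [LHS]card_scale_invariant.
  - congr (_ * _)%N; apply: eq_card => v; rewrite in_setI !inE.
    by case: (v != 0).
  - by rewrite !inE eqxx.
  by move=> c v c0; rewrite !inE scaler_eq0 negb_or c0.
rewrite cardsC1 card_mx mul1n; have := finNzRing_gt1 F.
move: q #|pts F| => [|[|k]] n // _; rewrite -pred_Sn => nE.
apply/eqP; rewrite -(eqn_pmul2r (m := k.+1)) // -nE -subn1; apply/eqP.
by clear nE; nia.
Qed.

Lemma num_points_nonzeros (p : {mpoly F[3]}) d : p \is d.-homog ->
  (num_points p + #|nonzeros p| = q ^ 2 + q + 1)%N.
Proof.
move=> hp; rewrite (num_pointsE hp) -card_pts.
rewrite -(cardsID [set v : V | p.@[v ord0] == 0] (pts F)); congr (_ + _)%N.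
  by apply: eq_card => v; rewrite !inE.
by apply: eq_card => v; rewrite !inE andbC.
Qed.

Lemma no_linear_component_blocking (p : {mpoly F[3]}) :
    p \is q.-homog -> no_linear_component p ->
  forall a : V, a != 0 -> exists2 v, dot a v = 0 & p.@[v ord0] != 0.
Proof.
move=> hp nolin a a0.
case: (boolP [exists v : V, (dot a v == 0) && (p.@[v ord0] != 0)]).
  by case/existsP => v /andP[/eqP av pv]; exists v.
rewrite negb_exists => /forallP novan.
have [|g pE] := homog_vanish_line hp a0; last by case: (nolin _ _ pE); apply: msize_lin.
by move=> v av; have := novan v; rewrite av eqxx negbK => /eqP.
Qed.

Lemma num_points_le (p : {mpoly F[3]}) :
    plane_curve q p -> no_linear_component p ->
    ~ (q = 4%N /\ proj_equivalent p (exceptional_quartic F)) ->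
  (num_points p <= (q - 1) * q + 1)%N.
Proof.
move=> [p0 hp] nolin nexc; rewrite leqNgt; apply/negP => big; apply: nexc.
have blocking := no_linear_component_blocking hp nolin.
(* At least [(q - 1) q + 2] zeros leave at most [2 q - 1] of the [q^2 + q + 1] points. *)
have small : (#|nonzeros p| <= 2 * q - 1)%N.
  move: big (num_points_nonzeros hp) (finNzRing_gt1 F).
  by move: (num_points p) #|nonzeros p| q; clear; nia.
have q4 : q = 4%N.
  apply/eqP; rewrite eqn_leq (card_ge4 hp blocking small) andbT -ltnS.
  exact: card_lt5 hp blocking small.
by split=> //; apply: proj_equivalent_exceptional.
Qed.

End Bound.

(** * A nonsingular curve that attains the bound *)

Section Extremal.

Local Open Scope ring_scope.

(** For [k = q], over the field with [q] elements, it is nonzero exactly at the [2 q] points of the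
    lines [X = 0] and [Z = 0] other than [(0 : 0 : 1)]. The ring is a parameter because singular
    points are sought over the algebraic closure. *)
Definition extremal (R : comNzRingType) (k : nat) : {mpoly R[3]} :=
  'X_(0 : 'I_3) ^+ k - 'X_(0 : 'I_3) * 'X_(2 : 'I_3) ^+ k.-1
  + 'X_(0 : 'I_3) ^+ k.-1 * 'X_(1 : 'I_3) - 'X_(1 : 'I_3) ^+ k.

Lemma mevalXn n (R : comNzRingType) (v : 'I_n -> R) (p : {mpoly R[n]}) k :
  (p ^+ k).@[v] = p.@[v] ^+ k.
Proof. exact: rmorphXn. Qed.

Lemma mderivXn n (R : comNzRingType) (i : 'I_n) (p : {mpoly R[n]}) k :
  (p ^+ k)^`M(i) = p^`M(i) * p ^+ k.-1 *+ k.
Proof.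
elim: k => [|k IHk]; first by rewrite mulr0n expr0 -mpolyC1 mderivC.
rewrite exprS mderivM IHk mulrnAr mulrS; congr (_ + _).
by case: k {IHk} => [|k]; rewrite ?mulr0n // mulrCA -exprS.
Qed.

Lemma mderivXU n (R : comNzRingType) (i j : 'I_n) :
  ('X_j : {mpoly R[n]})^`M(i) = (i == j)%:R.
Proof.
rewrite mderivX mnm1E eq_sym; case: eqP => [->|_]; last by rewrite scale0r.
have -> : (U_(j) - U_(j))%MM = 0%MM :> 'X_{1..n} by apply/mnmP => k; rewrite mnmBE subnn mnm0E.
by rewrite mpolyX0 scale1r.
Qed.

Variable F : finFieldType.
Local Notation q := #|F|.
Local Notation V := 'rV[F]_3.

Lemma meval_extremal (R : comNzRingType) (k : nat) (v : 'I_3 -> R) :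
  (extremal R k).@[v] = v 0 ^+ k - v 0 * v 2 ^+ k.-1 + v 0 ^+ k.-1 * v 1 - v 1 ^+ k.
Proof.
by rewrite /extremal mevalB mevalD mevalB !mevalM !mevalXn !mevalXU.
Qed.

Lemma meval_mderiv_extremal (R : comNzRingType) (k : nat) (v : 'I_3 -> R) (i : 'I_3) :
  ((extremal R k)^`M(i)).@[v] =
    (i == 0)%:R * v 0 ^+ k.-1 *+ k
    - ((i == 0)%:R * v 2 ^+ k.-1 + v 0 * ((i == 2)%:R * v 2 ^+ k.-2 *+ k.-1))
    + ((i == 0)%:R * v 0 ^+ k.-2 *+ k.-1 * v 1 + v 0 ^+ k.-1 * (i == 1)%:R)
    - (i == 1)%:R * v 1 ^+ k.-1 *+ k.
Proof.
rewrite /extremal mderivB mderivD mderivB !mderivM !mderivXn !mderivXU.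
rewrite mevalB mevalD mevalB !(mevalD, mevalMn, mevalM, mevalXn).
by rewrite !meval1 !mevalXU.
Qed.

Lemma extremal_homog : extremal F q \is q.-homog.
Proof.
have q0 := ltnW (finNzRing_gt1 F).
have hX i : ('X_i : {mpoly F[3]}) \is 1.-homog by rewrite dhomogX /= mdeg1.
have hXn i k : ('X_i ^+ k : {mpoly F[3]}) \is k.-homog.
  by have := dhomogMn k (hX i); rewrite mul1n.
rewrite /extremal; apply: rpredB; last exact: hXn 1 q.
apply: rpredD.
  apply: rpredB; first exact: hXn 0 q.
  by have := dhomogM (hX 0) (hXn 2 q.-1); rewrite add1n prednK.
by have := dhomogM (hXn 0 q.-1) (hX 1); rewrite addn1 prednK.
Qed.

Lemma extremal_eval0 (x y z : F) :
  ((extremal F q).@[row3 x y z ord0] == 0) =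
    ((x != 0) && (z != 0)) || ((x == 0) && (y == 0)).
Proof.
rewrite meval_extremal !row3E !expf_card.
have e0 : (0 : F) ^+ q.-1 = 0.
  by rewrite expr0n; have := finNzRing_gt1 F; case: q => [|[]].
case: (eqVneq x 0) => [->|x0] /=.
  by rewrite e0 !mul0r subr0 add0r sub0r oppr_eq0.
rewrite (expf_card_pred x0) mul1r addrK orbF.
case: (eqVneq z 0) => [->|z0]; first by rewrite e0 mulr0 subr0 (negPf x0).
by rewrite expf_card_pred // mulr1 subrr eqxx.
Qed.

Lemma extremal_neq0 : extremal F q != 0.
Proof.
apply/eqP => e0; have := extremal_eval0 0 1 0.
by rewrite e0 meval0 !eqxx oner_eq0.
Qed.

Lemma num_points_extremal : num_points (extremal F q) = ((q - 1) * q + 1)%N.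
Proof.
rewrite (num_pointsE extremal_homog).
have q1 := finNzRing_gt1 F.
pose r3 (t : F * F * F) : V := row3 t.1.1 t.1.2 t.2.
have r3_inj : injective r3.
  move=> [[x y] z] [[x' y'] z']; rewrite /r3 /= => /rowP e.
  by have := (e 0, e 1, e 2); rewrite !row3E => -[[-> ->] ->].
pose S := [set v : V | (v != 0) && ((extremal F q).@[v ord0] == 0)].
(* [T1] consists of the zeros with [x] and [z] nonzero, [T2] of the vectors of the point
   [(0 : 0 : 1)]. *)
pose T1 := setX (setX [set~ 0 : F] [set: F]) [set~ 0 : F].
pose T2 := setX (setX [set 0 : F] [set 0 : F]) [set~ 0 : F].
have cS : #|S| = (q.-1 * q * q.-1 + q.-1)%N.
  have -> : S = r3 @: (T1 :|: T2).
    apply/setP => v; rewrite inE; apply/idP/imsetP => [|[[[x y] z]]].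
      have -> : v = row3 (v ord0 0) (v ord0 1) (v ord0 2).
        by apply: row3P; rewrite row3E.
      move: (v ord0 0) (v ord0 1) (v ord0 2) => x y z; rewrite extremal_eval0.
      move=> /andP[v0 xyz]; exists (x, y, z) => //; rewrite !inE /= andbT.
      case/orP: xyz => [->//|/andP[/eqP x0 /eqP y0]]; rewrite x0 y0 eqxx /=.
      by apply: contraNneq v0 => z0; rewrite x0 y0 z0; apply/eqP/row3P; rewrite row3E mxE.
    rewrite !inE /= andbT => /orP h ->; rewrite /r3 /= extremal_eval0.
    apply/andP; split; last by case: h => [->|/andP[-> _]]; rewrite ?orbT.
    have z0 : z != 0 by case: h => /andP[].
    by apply: contraNneq z0 => /rowP/(_ 2); rewrite row3E mxE => ->.
  rewrite card_imset // cardsU.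
  have -> : T1 :&: T2 = set0.
    by apply/setP => -[[x y] z]; rewrite !inE /=; case: (x == 0); rewrite /= ?andbF.
  by rewrite cards0 subn0 !cardsX !cardsC1 cardsT !cards1 !mul1n.
have : (#|S| = #|[set v in pts F | (extremal F q).@[v ord0] == 0%R]| * q.-1)%N.
  rewrite [LHS]card_scale_invariant.
  - congr (_ * _)%N; apply: eq_card => v; rewrite in_setI !inE.
    by case: (v != 0); rewrite //= andbC.
  - by rewrite inE eqxx.
  move=> c v c0; rewrite !inE scaler_eq0 negb_or c0 /= => /andP[-> /eqP ev].
  by rewrite (homog_mevalZ _ _ extremal_homog) ev mulr0 eqxx.
rewrite cS; move: q1; move: q #|_| => [|[|k]] n //= _ nE.
by apply/eqP; rewrite -(eqn_pmul2r (m := k.+1)) // -nE; apply/eqP; clear nE; nia.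
Qed.

(** As [k = 0] in [R], the derivative in [Y] is [X^(k-1)], so [x = 0]; then the equation gives
    [y = 0], and the derivative in [X] gives [z = 0]. *)
Lemma extremal_singular (R : idomainType) (k : nat) (v : 'I_3 -> R) :
    (1 < k)%N -> k%:R = 0 :> R -> (extremal R k).@[v] = 0 ->
    (forall i, ((extremal R k)^`M(i)).@[v] = 0) ->
  forall i, v i = 0.
Proof.
move=> k1 kR; rewrite meval_extremal => fv dv.
have k0 : (k == 0)%N = false by rewrite gtn_eqF // ltnW.
have kp0 : (k.-1 == 0)%N = false by case: k k1 {kR fv dv k0} => [|[]].
have e0 : (0 : R) ^+ k.-1 = 0 by rewrite expr0n kp0.
have kn (x : R) : x *+ k = 0 by rewrite -mulr_natr kR mulr0.
have x0 : v 0 = 0.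
  have := dv 1; rewrite meval_mderiv_extremal /= !kn.
  rewrite !(mul0r, mul0rn, mulr0, mulr1, addr0, add0r, oppr0) => /eqP.
  by rewrite expf_eq0 => /andP[_ /eqP].
have y0 : v 1 = 0.
  move: fv; rewrite x0 e0 expr0n k0 !(mul0r, addr0, add0r, oppr0) => /eqP.
  by rewrite oppr_eq0 expf_eq0 => /andP[_ /eqP].
(* For [k = 2] the factor [v 0 ^+ k.-2] is 1, so the term with [v 1] disappears only thanks to
   [y0]. *)
have z0 : v 2 = 0.
  have := dv 0; rewrite meval_mderiv_extremal /= !kn x0 y0.
  rewrite !(mulr0, mul0r, mul0rn, addr0, add0r, oppr0, mul1r) => /eqP.
  by rewrite oppr_eq0 expf_eq0 => /andP[_ /eqP].
exact: ord3P.
Qed.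

Lemma extremal_nonsingular : nonsingular (extremal F q).
Proof.
move=> v /rV0Pn[i vi] [].
have -> : map_mpoly (to_alg_closure F) (extremal F q) = extremal (alg_closure F) q.
  by rewrite /extremal rmorphB rmorphD rmorphB !rmorphM !rmorphXn /= !map_mpolyX.
have qK : q%:R = 0 :> alg_closure F.
  by rewrite -(rmorph_nat (to_alg_closure F)) natr_card_eq0 rmorph0.
move=> fv dv; move/eqP: vi; apply.
exact: (extremal_singular (finNzRing_gt1 F) qK fv dv).
Qed.

End Extremal.

Theorem theorem1 (q : nat) (hq : prime_power q)
    (F : finFieldType) (hF : #|F| = q) :
  (forall f : {mpoly F[3]},
      plane_curve q f ->
      no_linear_component f ->
      ~ (q = 4 /\ proj_equivalent f (exceptional_quartic F)) ->
      num_points f <= (q - 1) * q + 1)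
  /\
  (exists f : {mpoly F[3]},
      [/\ plane_curve q f, nonsingular f & num_points f = (q - 1) * q + 1]).
Proof.
rewrite -{q hq}hF; split=> [f|]; first exact: num_points_le.
exists (extremal F #|F|); split; last exact: num_points_extremal.
  by split; [exact: extremal_neq0 | exact: extremal_homog].
exact: extremal_nonsingular.
Qed.
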